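(* Let $n\geq2$, $m\geq1$ be integers, $\alpha,\beta\in\mathbb{C}$, $T=J_n(\alpha)\oplus\beta I_m\in M_{n+m}(\mathbb{C})$, $k\in\{1,\ldots,n+m\}$, and let $\psi\in\mathbb{R}$ satisfy $\beta-\alpha=|\beta-\alpha|e^{i\psi}$. Then: (1) if $1\leq k\leq n/2$ and $|\beta-\alpha|\leq\cos\phi_k$: $\Lambda_k(T)=B_{\cos\phi_k}(\alpha)$; (2) if $1\leq k\leq n/2$, $k\leq m$, $|\beta-\alpha|>\cos\phi_k$: $\Lambda_k(T)=B_{\cos\phi_k}(\alpha)\cup(\widetilde E^{\psi}_k\cap R^{\psi}_{|\beta-\alpha|,k})$; (3) if $1\leq k\leq n/2$, $k>m$, $|\beta-\alpha|>\cos\phi_k$: $\Lambda_k(T)=B_{\cos\phi_k}(\alpha)\cup(\widetilde E^{\psi}_k\cap R^{\psi}_{|\beta-\alpha|,k}\cap B_{\cos\psi_{k,m}}(\alpha))$; (4) if $k=\frac{n+1}{2}\leq m$, or $k=\frac{n+1}{2}>m$ and $|\beta-\alpha|\leq\cos\psi_{k,m}$: $\Lambda_k(T)=[\alpha,\beta]$; (5) if $k=\frac{n+1}{2}>m$ and $|\beta-\alpha|>\cos\psi_{k,m}$: $\Lambda_k(T)=\{\alpha+t(\beta-\alpha)\cos\eta_{k,m}:\ t\in[0,1]\}$; (6) if $\frac{n+1}{2}<k\leq m$, or $\frac{n+1}{2}<k$, $m<k$ and $|\beta-\alpha|\leq\cos\psi_{k,m}$: $\Lambda_k(T)=\{\beta\}$;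 (7) if $\frac{n+1}{2}<k$, $m<k$ and $|\beta-\alpha|>\cos\psi_{k,m}$: $\Lambda_k(T)=\emptyset$.
   Context: $J_n(\alpha)$ is the $n\times n$ Jordan block with eigenvalue $\alpha$. For $T\in M_N(\mathbb{C})$, $\Lambda_k(T)=\{\lambda\in\mathbb{C}:\ \text{there is a rank-}k\text{ orthogonal projection }P\text{ with }PTP=\lambda P\}$. $\phi_k=\frac{k\pi}{n+1}$, $\psi_{k,m}=\frac{(k-m)\pi}{n+1}$. $D_k=\{\theta\in\mathbb{R}:\ |\beta-\alpha|\cos\theta\leq\cos\phi_k\}$; $\delta_k=\arccos(\cos\phi_k/|\beta-\alpha|)\in[0,\pi]$ if $\beta\neq\alpha$ and $|\beta-\alpha|\geq|\cos\phi_k|$, and $\delta_k=0$ otherwise; $\eta_{k,m}=\arccos(\cos\psi_{k,m}/|\beta-\alpha|)\in[0,\pi]$ if $k>m$, $\beta\neq\alpha$ and $|\beta-\alpha|\geq|\cos\psi_{k,m}|$, and $\eta_{k,m}=0$ otherwise. $\widetilde E_k=\{\mu\in\mathbb{C}:\ \arg\mu\notin D_k\}$. $B_r(\lambda)$ is the closed disk of radius $r$ centered at $\lambda$ (empty if $r<0$). For $r\geq0$, $R_{r,k}=\{x+iy:\ x\leq r,\ (x-r)\cot\delta_k\leq y\leq(r-x)\cot\delta_k\}$. $\widetilde E^{\psi}_k=\alpha+e^{i\psi}\widetilde E_k$ and $R^{\psi}_{r,k}=\alpha+e^{i\psi}R_{r,k}$. $[\alpha,\beta]=\{(1-t)\alpha+t\beta:\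 t\in[0,1]\}$. *)

(* Defs.v *)
From HB Require Import structures.
From mathcomp Require Import all_boot all_order all_algebra.
From mathcomp Require Import complex.
From mathcomp Require Import all_classical all_reals.
From mathcomp Require Import trigo.
Set Implicit Arguments. Unset Strict Implicit. Unset Printing Implicit Defensive.
Import Order.TTheory GRing.Theory Num.Theory.
Local Open Scope ring_scope.
Local Open Scope classical_set_scope.

Section Defs.
Variable R : realType.
Local Notation C := (complex R).

Definition cmod (z : C) : R := Num.sqrt (complex.Re z ^+ 2 + complex.Im z ^+ 2).

Definition expi (t : R) : C := Complex (cos t) (sin t).

Definition adjmx (p q : nat) (A : 'M[C]_(p, q)) : 'M[C]_(q, p) :=
  (map_mx (@conjc R) A)^T.

Definition jordan_block (n : nat) (a : C) : 'M[C]_n :=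
  \matrix_(i < n, j < n)
    (if i == j :> nat then a else if j == i.+1 :> nat then 1 else 0).

Definition Tmat (n m : nat) (alpha beta : C) : 'M[C]_(n + m) :=
  block_mx (jordan_block n alpha) 0 0 (beta%:M).

Definition orth_proj_rank (N k : nat) (P : 'M[C]_N) : Prop :=
  adjmx P = P /\ P *m P = P /\ \rank P = k.

Definition rank_k_numrange (N k : nat) (T : 'M[C]_N) : set C :=
  [set lam | exists P : 'M[C]_N, orth_proj_rank k P /\ P *m T *m P = lam *: P].

(* closed disk B_r(lam) (empty when r < 0) *)
Definition cdisk (r : R) (lam : C) : set C := [set z | cmod (z - lam) <= r].

Definition phi_ (n k : nat) : R := k%:R * pi / (n.+1)%:R.
Definition psi_ (n k m : nat) : R := (k%:R - m%:R) * pi / (n.+1)%:R.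

Definition Dset (n k : nat) (d : R) : set R := [set t | d * cos t <= cos (phi_ n k)].

Definition delta_ (n k : nat) (alpha beta : C) : R :=
  let d := cmod (beta - alpha) in
  if (beta != alpha) && (`|cos (phi_ n k)| <= d)
  then acos (cos (phi_ n k) / d) else 0.

Definition eta_ (n k m : nat) (alpha beta : C) : R :=
  let d := cmod (beta - alpha) in
  if [&& (m < k)%N, beta != alpha & `|cos (psi_ n k m)| <= d]
  then acos (cos (psi_ n k m) / d) else 0.

Definition cot (t : R) : R := cos t / sin t.

(* tilde E_k = {mu | arg mu \notin D_k}; arg mu is any theta with
   mu = |mu| e^{i theta} *)
Definition Etilde (n k : nat) (alpha beta : C) : set C :=
  [set mu | exists t : R, mu = (cmod mu)%:C%C * expi t /\
            ~ Dset n k (cmod (beta - alpha)) t].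

Definition Rregion (n k : nat) (alpha beta : C) (r : R) : set C :=
  let c := cot (delta_ n k alpha beta) in
  [set z | complex.Re z <= r /\ (complex.Re z - r) * c <= complex.Im z /\ complex.Im z <= (r - complex.Re z) * c].

Definition rot_shift (alpha : C) (ps : R) (S : set C) : set C :=
  [set z | exists2 w, S w & z = alpha + expi ps * w].

Definition Etilde_psi n k alpha beta ps := rot_shift alpha ps (Etilde n k alpha beta).
Definition Rregion_psi n k alpha beta ps r := rot_shift alpha ps (Rregion n k alpha beta r).

Definition segment (alpha beta : C) : set C :=
  [set z | exists2 t : R, 0 <= t <= 1 & z = (1 - t)%:C%C * alpha + t%:C%C * beta].

End Defs.
Arguments phi_ {R}.
Arguments psi_ {R}.

(* Main.v *)
Require Import Defs.
From HB Require Import structures.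
From mathcomp Require Import all_boot all_order all_algebra.
From mathcomp Require Import complex.
From mathcomp Require Import all_classical all_reals.
From mathcomp Require Import trigo ring lra zify.
Set Implicit Arguments. Unset Strict Implicit. Unset Printing Implicit Defensive.
Import Order.TTheory GRing.Theory Num.Theory.
Local Open Scope ring_scope.
Local Open Scope classical_set_scope.

(** Put [nu = lam - alpha], [Q = J_n(alpha) - lam = J_n(-nu)], [J = J_n(0)] and
    [c_j = cos (j pi / (n+1))], and write [A'] for the adjoint of [A].  The point
    [lam] lies in [Lambda_k(T)] iff some [k] independent row vectors [u_i] satisfy
    [u_i (T - lam) u_j' = 0] for all [i], [j].

    Everything rests on the vectors [x_l = t^l sin (l phi_j)], which satisfy
    [t x J + t^-1 x J' = 2 c_j x].

    For [|t| = 1] they diagonalise [t J + (t J)']; intersecting the range of a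
    rank-[k] projection with the span of those with index at least [k], plus the
    summand [C^m], or with the span of those with index at least [k - m], bounds
    [Re (t (lam - alpha))] from above.

    Conversely, if [nu t^2 - 2 c_j t + nu' = 0] then [x Q' = - t^2 x Q], so that
    [x Q y' = 0] for two such vectors with parameters [t], [s] unless
    [(t s')^2 = 1].  When [c_j >= |nu|] a root [t] with [|t| <= 1] makes [x] itself
    neutral.  When [0 <= c_j < |nu|] both roots are unimodular, the quotients
    [x J x' / |x|^2] are the points where the tangents from [nu] touch the circle
    of radius [c_j], and some combination of the two vectors with a unit vector of
    [C^m] is neutral exactly when [nu] lies in the triangle spanned by these two
    points and [beta - alpha]. *)

(** Applying the product of [M - z] over a list of scalars [z] to a relation [a V = 0] multiplies
    its [j]-th coefficient by the product of the [d j - z]; the list of all other eigenvalues leaves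
    the [j]-th term alone. *)
Lemma row_free_eigenrows (F : fieldType) (p n : nat) (V : 'M[F]_(p, n))
    (M : 'M[F]_n) (d : 'I_p -> F) :
  injective d -> (forall i, row i V != 0) ->
  (forall i, row i V *m M = d i *: row i V) -> row_free V.
Proof.
move=> d_inj V_neq0 VM.
rewrite -kermx_eq0; apply/eqP/row_matrixP => i0; rewrite row0.
set a := row i0 _.
have aV : a *m V = 0 by rewrite -row_mul mulmx_ker row0.
have aVs s : \sum_j (a 0 j * \prod_(z <- s) (d j - z)) *: row j V = 0.
  elim: s => [|z s IHs].
    rewrite -[RHS]aV mulmx_sum_row; apply: eq_bigr => j _.
    by rewrite big_nil mulr1.
  have := congr1 (mulmx^~ (M - z%:M)) IHs; rewrite mul0mx mulmx_suml => IHM.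
  rewrite -[RHS]IHM; apply: eq_bigr => j _.
  rewrite -scalemxAl mulmxBr VM mul_mx_scalar -scalerBl scalerA big_cons.
  by congr (_ *: _); ring.
apply/rowP => j; rewrite [RHS]mxE.
have := aVs [seq d l | l <- enum 'I_p & l != j].
rewrite (bigD1 j) //= [X in _ + X]big1 ?addr0 => [|l l_neq].
  move/eqP; rewrite scaler_eq0 (negPf (V_neq0 j)) orbF mulf_eq0 => /orP[/eqP //|].
  rewrite prodf_seq_eq0 => /hasP[z /mapP[l]]; rewrite mem_filter => /andP[l_neq _] -> /=.
  by rewrite subr_eq0 => /eqP/d_inj jl; rewrite jl eqxx in l_neq.
suff -> : \prod_(z <- [seq d l0 | l0 <- enum 'I_p & l0 != j]) (d l - z) = 0.
  by rewrite mulr0 scale0r.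
apply/eqP; rewrite prodf_seq_eq0; apply/hasP; exists (d l); last by rewrite subrr /=.
by apply/mapP; exists l => //; rewrite mem_filter l_neq mem_enum.
Qed.

(** * Sesquilinear forms and the numerical range *)

Section Adjoint.
Variable R : realType.
Local Notation C := (complex R).

Lemma adjmxM m n p (A : 'M[C]_(m, n)) (B : 'M[C]_(n, p)) :
  adjmx (A *m B) = adjmx B *m adjmx A.
Proof. by rewrite /adjmx map_mxM trmx_mul. Qed.

Lemma adjmxD m n (A B : 'M[C]_(m, n)) : adjmx (A + B) = adjmx A + adjmx B.
Proof. by rewrite /adjmx map_mxD linearD. Qed.

Lemma adjmxZ m n (c : C) (A : 'M[C]_(m, n)) : adjmx (c *: A) = conjc c *: adjmx A.
Proof. by rewrite /adjmx map_mxZ linearZ. Qed.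

Lemma adjmxK m n (A : 'M[C]_(m, n)) : adjmx (adjmx A) = A.
Proof. by apply/matrixP => i j; rewrite !mxE conjcK. Qed.

Lemma adjmx0 m n : adjmx (0 : 'M[C]_(m, n)) = 0.
Proof. by apply/matrixP => i j; rewrite !mxE conjc0. Qed.

Lemma adjmx1 n : adjmx (1%:M : 'M[C]_n) = 1%:M.
Proof. by rewrite /adjmx map_mx1 trmx1. Qed.

Lemma adjmx_row_mx m n p (A : 'M[C]_(m, n)) (B : 'M[C]_(m, p)) :
  adjmx (row_mx A B) = col_mx (adjmx A) (adjmx B).
Proof. by rewrite /adjmx map_row_mx tr_row_mx. Qed.

Definition mxform n (A : 'M[C]_n) (x y : 'rV[C]_n) : C := (x *m A *m adjmx y) 0 0.

Lemma mxform_rows n p q (A : 'M[C]_n) (U : 'M[C]_(p, n)) (V : 'M[C]_(q, n)) i j :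
  (U *m A *m adjmx V) i j = mxform A (row i U) (row j V).
Proof.
rewrite /mxform -row_mul !mxE; apply: eq_bigr => l _; by rewrite !mxE.
Qed.

Lemma mxform0l n (A : 'M[C]_n) y : mxform A 0 y = 0.
Proof. by rewrite /mxform !mul0mx mxE. Qed.

Lemma mxform0r n (A : 'M[C]_n) x : mxform A x 0 = 0.
Proof. by rewrite /mxform adjmx0 mulmx0 mxE. Qed.

Lemma mxformDl n (A : 'M[C]_n) x y z : mxform A (x + y) z = mxform A x z + mxform A y z.
Proof. by rewrite /mxform !mulmxDl mxE. Qed.

Lemma mxformDr n (A : 'M[C]_n) x y z : mxform A z (x + y) = mxform A z x + mxform A z y.
Proof. by rewrite /mxform adjmxD mulmxDr mxE. Qed.

Lemma mxformZl n (A : 'M[C]_n) c x z : mxform A (c *: x) z = c * mxform A x z.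
Proof. by rewrite /mxform -!scalemxAl mxE. Qed.

Lemma mxformZr n (A : 'M[C]_n) c x z : mxform A z (c *: x) = conjc c * mxform A z x.
Proof. by rewrite /mxform adjmxZ -!scalemxAr mxE. Qed.

Lemma conjc_mxform n (A : 'M[C]_n) x y : conjc (mxform A x y) = mxform (adjmx A) y x.
Proof.
rewrite /mxform -[y in RHS]adjmxK -mulmxA -!adjmxM !mulmxA.
by rewrite /adjmx !mxE.
Qed.

Definition normsq n (x : 'rV[C]_n) : R :=
  \sum_i (complex.Re (x 0 i) ^+ 2 + complex.Im (x 0 i) ^+ 2).

Lemma mul_adjmxE n (x : 'rV[C]_n) : (x *m adjmx x) 0 0 = (normsq x)%:C%C.
Proof.
rewrite mxE rmorph_sum; apply: eq_bigr => i _; rewrite !mxE.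
by case: (x 0 i) => a b; apply/eqP; rewrite eq_complex /=; apply/andP; split; apply/eqP; ring.
Qed.

Lemma normsq_ge0 n (x : 'rV[C]_n) : 0 <= normsq x.
Proof. by apply: sumr_ge0 => i _; rewrite addr_ge0 ?sqr_ge0. Qed.

Lemma normsq_eq0 n (x : 'rV[C]_n) : normsq x = 0 -> x = 0.
Proof.
move=> /eqP; rewrite psumr_eq0 => [/allP x0|i _]; last by rewrite addr_ge0 ?sqr_ge0.
apply/rowP => i; have := x0 i (mem_index_enum _); rewrite mxE /=.
rewrite paddr_eq0 ?sqr_ge0 // !sqrf_eq0; case: (x 0 i) => a b /= /andP[/eqP-> /eqP->].
by [].
Qed.

(** If [a U U' = 0] then [|a U|^2 = a U U' a'] vanishes. *)
Lemma gram_unit k N (U : 'M[C]_(k, N)) : row_free U -> U *m adjmx U \in unitmx.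
Proof.
move=> Ufree; rewrite -row_free_unit -kermx_eq0; apply/eqP/row_matrixP => i.
rewrite row0; set a := row i _.
have aG : a *m (U *m adjmx U) = 0 by rewrite -row_mul mulmx_ker row0.
have : normsq (a *m U) = 0.
  apply: (@complexI R); rewrite -mul_adjmxE adjmxM mulmxA -(mulmxA a) aG.
  by rewrite mul0mx mxE.
by move=> /normsq_eq0/eqP; rewrite mulmx_free_eq0 // => /eqP.
Qed.

(** The orthogonal projection onto the row space of [U] is [U' (U U')^-1 U]; the inverse Gram matrix
    takes the place of orthonormalising the rows. *)
Lemma rank_k_numrangeI N k (T : 'M[C]_N) (lam : C) (U : 'M[C]_(k, N)) :
  row_free U -> U *m (T - lam%:M) *m adjmx U = 0 -> rank_k_numrange k T lam.
Proof.
move=> Ufree UTU; set G := U *m adjmx U.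
have Gunit : G \in unitmx by exact: gram_unit.
have adjG : adjmx G = G by rewrite /G adjmxM adjmxK.
have adjGV : adjmx (invmx G) = invmx G.
  rewrite -[LHS](mulmxK Gunit) -[X in _ *m X *m _]adjG -adjmxM mulmxV //.
  by rewrite adjmx1 mul1mx.
exists (adjmx U *m invmx G *m U); split; last first.
  have {}UTU : U *m T *m adjmx U = lam *: G.
    by apply/subr0_eq; rewrite -[RHS]UTU mulmxBr mulmxBl mul_mx_scalar -scalemxAl.
  rewrite -!mulmxA (mulmxA U) (mulmxA (U *m T)) UTU -scalemxAl -!scalemxAr.
  by rewrite (mulmxA G) mulmxV // mul1mx.
split; first by rewrite !adjmxM adjmxK adjGV mulmxA.
split.
  rewrite !mulmxA -(mulmxA _ U) -/G.
  by rewrite -(mulmxA _ (invmx G) G) mulVmx // mulmx1.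
have Urank : \rank U = k by apply/eqP.
set P := _ *m U; have UP : U = U *m P by rewrite /P !mulmxA mulmxV // mul1mx.
apply/eqP; rewrite eqn_leq; apply/andP; split.
  by apply: leq_trans (mxrankM_maxr _ _) _; rewrite Urank.
by rewrite -[X in (X <= _)%N]Urank {1}UP; exact: mxrankM_maxr.
Qed.

(** The dimensions of the row spaces of [W] and [P] add up to more than [N], so they share a nonzero
    [x]; as [x P = x], the form at [x] is that of [P (T - lam) P = 0]. *)
Lemma rank_k_numrangeE N k q (T : 'M[C]_N) (lam : C) (W : 'M[C]_(q, N)) :
  rank_k_numrange k T lam -> row_free W -> (N < q + k)%N ->
  exists2 a : 'rV[C]_q, a != 0 & mxform (T - lam%:M) (a *m W) (a *m W) = 0.
Proof.
move=> [P [[adjP [PP rankP]] PTP]] Wfree ltN.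
have : \rank (W :&: P)%MS != 0%N.
  apply/eqP => cap0; have := mxrank_sum_cap W P; rewrite cap0 addn0 rankP.
  have -> : \rank W = q by apply/eqP.
  by have := rank_leq_col (W + P)%MS; lia.
rewrite mxrank_eq0 => cap_neq0.
have := nz_row_sub (W :&: P)%MS; rewrite sub_capmx => /andP[/submxP[a aW] /submxP[b bP]].
move: aW bP; rewrite -nz_row_eq0 in cap_neq0; move: (nz_row _) cap_neq0 => x x_neq0 xaW xbP.
exists a; first by apply: contra_neq x_neq0 => a0; rewrite xaW a0 mul0mx.
rewrite -xaW.
have xP : x *m P = x by rewrite xbP -mulmxA PP.
rewrite /mxform mulmxBr mulmxBl -[in X in X - _]xP adjmxM adjP mulmxA.
rewrite -2!(mulmxA x) PTP -scalemxAr xP mul_mx_scalar -!scalemxAl subrr.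
by rewrite mxE.
Qed.
End Adjoint.
(** * The vectors t^l sin (l phi) *)

Section PhiFacts.
Variable R : realType.

(** The sines vanish at [l = n + 1] as they do at [l = 0]; these boundary values free the shifts by
    [J] and [J'] from exceptional columns. *)
Lemma sin_phi (n k : nat) : sin (n.+1%:R * phi_ n k) = 0 :> R.
Proof.
rewrite /phi_ mulrC divfK ?pnatr_eq0 //.
elim: k => [|k IHk]; first by rewrite mul0r sin0.
by rewrite -addn1 natrD mulrDl mul1r sinDpi IHk oppr0.
Qed.

Lemma phi_itv (n k : nat) : (k <= n.+1)%N -> 0 <= (phi_ n k : R) <= pi.
Proof.
move=> k_le; rewrite /phi_ divr_ge0 ?mulr_ge0 ?ler0n ?pi_ge0 //=.
by rewrite ler_pdivrMr ?ltr0n // mulrC ler_wpM2l ?pi_ge0 // ler_nat.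
Qed.

Lemma phi_lt (n j k : nat) : (j < k)%N -> (phi_ n j : R) < phi_ n k.
Proof. by move=> jk; rewrite /phi_ ltr_pM2r ?invr_gt0 ?ltr0n // ltr_pM2r ?pi_gt0 // ltr_nat. Qed.

Lemma sin_phi_gt0 (n k : nat) : (0 < k <= n)%N -> 0 < sin (phi_ n k) :> R.
Proof.
move=> /andP[k0 kn]; apply: sin_gt0_pi; apply/andP; split.
  by rewrite /phi_ divr_gt0 ?mulr_gt0 ?ltr0n ?pi_gt0.
have <- : phi_ n n.+1 = pi :> R by rewrite /phi_ mulrAC divff ?mul1r ?pnatr_eq0.
exact: phi_lt.
Qed.

Lemma cos_phi_lt (n j k : nat) :
  (j < k)%N -> (k <= n.+1)%N -> cos (phi_ n k) < cos (phi_ n j) :> R.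
Proof.
by move=> jk kn; rewrite ltr_cos ?in_itv /= ?phi_itv ?phi_lt //; lia.
Qed.

Lemma cos_phi_le (n j k : nat) :
  (j <= k)%N -> (k <= n.+1)%N -> cos (phi_ n k) <= cos (phi_ n j) :> R.
Proof. by rewrite leq_eqVlt => /orP[/eqP-> //|jk kn]; exact/ltW/cos_phi_lt. Qed.

(** Reduces the sign of the cosine to comparing [2 k] with [n + 1]. *)
Lemma phi_pihalf (n k : nat) : (phi_ n k - pi / 2 : R) = (k.*2%:R - n.+1%:R) * (pi / (2 * n.+1%:R)).
Proof.
have : (n.+1%:R : R) != 0 by rewrite pnatr_eq0.
rewrite /phi_ -muln2 natrM; move: (n.+1%:R) => N N0.
by field.
Qed.

Lemma cos_phi_half (n k : nat) : k.*2 = n.+1 -> cos (phi_ n k) = 0 :> R.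
Proof.
move=> kn; rewrite -[RHS]cos_pihalf; congr cos.
by apply/eqP; rewrite -subr_eq0 phi_pihalf kn subrr mul0r.
Qed.

Lemma cos_phi_gt0 (n k : nat) : (k.*2 <= n)%N -> 0 < cos (phi_ n k) :> R.
Proof.
move=> kn; apply: cos_gt0_pihalf; apply/andP; split.
  have /andP[phi_ge0 _] := @phi_itv n k (ltac:(lia)).
  by rewrite (lt_le_trans _ phi_ge0) // oppr_lt0 divr_gt0 ?pi_gt0.
rewrite -subr_lt0 phi_pihalf pmulr_llt0 ?divr_gt0 ?mulr_gt0 ?ltr0n ?pi_gt0 //.
by rewrite subr_lt0 ltr_nat.
Qed.

Lemma cos_phi_lt0 (n k : nat) : (n.+1 < k.*2)%N -> (k <= n.+1)%N -> cos (phi_ n k) < 0 :> R.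
Proof.
move=> kn k_le; rewrite -[X in _ < X]cos_pihalf ltr_cos ?in_itv /= ?phi_itv //.
  rewrite -subr_gt0 phi_pihalf pmulr_lgt0 ?divr_gt0 ?mulr_gt0 ?ltr0n ?pi_gt0 //.
  by rewrite subr_gt0 ltr_nat.
by rewrite divr_ge0 ?pi_ge0 //= ler_pdivrMr // ler_peMr ?pi_ge0 // ler1n.
Qed.

Lemma cos_phi_ge0 (n k : nat) : (k <= n.+1)%N -> 0 <= cos (phi_ n k) :> R -> (k.*2 <= n.+1)%N.
Proof. by move=> kn; rewrite leqNgt; apply: contraTN => /cos_phi_lt0 -/(_ kn); rewrite -ltNge. Qed.

Lemma psi_phi (n k m : nat) : (m <= k)%N -> psi_ n k m = phi_ n (k - m) :> R.
Proof. by move=> mk; rewrite /psi_ /phi_ natrB. Qed.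

End PhiFacts.

(** * Jordan blocks acting on sine vectors *)

Section Jordan.
Variable R : realType.
Local Notation C := (complex R).

Lemma conjcM (x y : C) : conjc (x * y) = conjc x * conjc y.
Proof. exact: rmorphM. Qed.
Lemma conjcD (x y : C) : conjc (x + y) = conjc x + conjc y.
Proof. exact: rmorphD. Qed.
Lemma conjcN (x : C) : conjc (- x) = - conjc x.
Proof. exact: rmorphN. Qed.

(** Entry [l] holds [g l.+1], so [g 0] and [g n.+1] are the boundary values just outside the
    vector. *)
Definition seqvec n (g : nat -> C) : 'rV[C]_n := \row_l g l.+1.

Lemma jordan_blockE n (a : C) (i j : 'I_n) :
  jordan_block n a i j = (if i == j then a else 0) + (if j == i.+1 :> nat then 1 else 0).
Proof.
rewrite mxE -val_eqE /=; case: eqP => [->|_]; last by rewrite add0r.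
by case: eqP => [|_]; [lia|rewrite addr0].
Qed.

Lemma mul_jordan n (g : nat -> C) a : g 0 = 0 ->
  seqvec n g *m jordan_block n a = seqvec n (fun l => a * g l + g l.-1).
Proof.
move=> g0; apply/rowP => l; rewrite !mxE.
under eq_bigr => i _ do rewrite jordan_blockE mulrDr mxE.
rewrite big_split /=; congr (_ + _).
  rewrite (bigD1 l) //= eqxx mulrC big1 ?addr0 // => i /negPf->.
  by rewrite mulr0.
case: l => -[|l] ltl /=.
  by rewrite g0 big1 // => i _; rewrite mulr0.
have ltl' : (l < n)%N by exact: ltnW.
rewrite (bigD1 (Ordinal ltl')) //= eqxx mulr1 big1 ?addr0 // => i.
rewrite -val_eqE /= eqSS eq_sym => /negPf->; by rewrite mulr0.
Qed.

Lemma mul_adj_jordan n (g : nat -> C) a : g n.+1 = 0 ->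
  seqvec n g *m adjmx (jordan_block n a) = seqvec n (fun l => conjc a * g l + g l.+1).
Proof.
move=> gn; apply/rowP => l; rewrite !mxE.
have E i : conjc (jordan_block n a l i) = (if i == l then conjc a else 0) +
    (if i == l.+1 :> nat then 1 else 0).
  rewrite jordan_blockE conjcD eq_sym; congr (_ + _); first by case: eqP; rewrite ?conjc0.
  by case: eqP; rewrite ?conjc0 ?conjc1.
transitivity (\sum_(i < n) g i.+1 * conjc (jordan_block n a l i)).
  by apply: eq_bigr => i _; rewrite !mxE.
under eq_bigr => i _ do rewrite E mulrDr.
rewrite big_split /=; congr (_ + _).
  rewrite (bigD1 l) //= eqxx mulrC big1 ?addr0 // => i /negPf->.
  by rewrite mulr0.
have [ltl|] := ltnP l.+1 n.
  rewrite (bigD1 (Ordinal ltl)) //= eqxx mulr1 big1 ?addr0 // => i.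
  by rewrite -val_eqE /= => /negPf->; rewrite mulr0.
move=> le_n; have ln : l.+1 = n by have := ltn_ord l; lia.
rewrite ln gn big1 // => i _; case: eqP => [il|]; last by rewrite mulr0.
by have := ltn_ord i; lia.
Qed.

Definition sinseq (t : C) (f : R) (l : nat) : C := t ^+ l * (sin (l%:R * f))%:C%C.

Definition svec n (t : C) (f : R) : 'rV[C]_n := seqvec n (sinseq t f).

Lemma sinseq_rec t f l : t != 0 ->
  t * sinseq t f l + t^-1 * sinseq t f l.+2 = 2 * (cos f)%:C%C * sinseq t f l.+1.
Proof.
move=> t0; rewrite /sinseq.
have -> : l%:R * f = l.+1%:R * f - f by rewrite -(addn1 l) natrD; ring.
have -> : l.+2%:R * f = l.+1%:R * f + f by rewrite -(addn1 l.+1) natrD; ring.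
rewrite sinB sinD rmorphB rmorphD !rmorphM /= !exprS; field.
exact: t0.
Qed.

Lemma sinseq0 t f : sinseq t f 0 = 0.
Proof. by rewrite /sinseq mul0r sin0 mulr0. Qed.

Lemma svec_jordan n t f a : t != 0 -> sin (n.+1%:R * f) = 0 ->
  t *: (svec n t f *m jordan_block n a) + t^-1 *: (svec n t f *m adjmx (jordan_block n a))
  = (2 * (cos f)%:C%C + t * a + t^-1 * conjc a) *: svec n t f.
Proof.
move=> t0 sinn; rewrite mul_jordan ?sinseq0 // mul_adj_jordan; last first.
  by rewrite /sinseq sinn mulr0.
apply/rowP => l; rewrite !mxE /= 2!mulrDl -sinseq_rec //.
by ring.
Qed.

(** The condition on [t] makes the eigenvalue in [svec_jordan] zero, so the two terms on its left
    cancel. *)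
Lemma svec_jordan_adj n t f a : t != 0 -> sin (n.+1%:R * f) = 0 ->
  2 * (cos f)%:C%C * t + t ^+ 2 * a + conjc a = 0 ->
  svec n t f *m adjmx (jordan_block n a) = - t ^+ 2 *: (svec n t f *m jordan_block n a).
Proof.
move=> t0 sinn eqt; have := svec_jordan a t0 sinn.
have -> : 2 * (cos f)%:C%C + t * a + t^-1 * conjc a = t^-1 * (2 * (cos f)%:C%C * t + t ^+ 2 * a
  + conjc a).
  by field.
rewrite eqt mulr0 scale0r => /(congr1 ( *:%R t)).
rewrite scalerDr !scalerA mulfV // scale1r scaler0 -expr2 => /eqP.
by rewrite addrC addr_eq0 => /eqP ->; rewrite scaleNr.
Qed.

(** Conjugation gives [x Q y' = nu' (x Q' y')], while [x Q' y' = mu (x Q y')]: the value is [mu nu']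
    times itself. *)
Lemma mxform_eig0 n (Q : 'M[C]_n) (x y : 'rV[C]_n) (mu nu : C) :
  x *m adjmx Q = mu *: (x *m Q) -> y *m adjmx Q = nu *: (y *m Q) ->
  mu * conjc nu != 1 -> mxform Q x y = 0.
Proof.
move=> xQ yQ munu.
have E : mxform Q x y = (mu * conjc nu) * mxform Q x y.
  have Ex : mxform (adjmx Q) x y = mu * mxform Q x y.
    by rewrite /mxform xQ -scalemxAl mxE.
  have Ey : mxform (adjmx Q) y x = nu * mxform Q y x.
    by rewrite /mxform yQ -scalemxAl mxE.
  rewrite -mulrA [_ * mxform _ _ _]mulrC mulrA -Ex.
  have -> : mxform (adjmx Q) x y = conjc (mxform Q y x) by rewrite conjc_mxform.
  by rewrite mulrC -conjcM -Ey conjc_mxform adjmxK.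
move/eqP: E; rewrite -subr_eq0 -{1}[mxform Q x y]mul1r -mulrBl mulf_eq0 subr_eq0.
by rewrite eq_sym (negPf munu) => /eqP.
Qed.

Lemma normsq_svec n t f : t * conjc t = 1 ->
  normsq (svec n t f) = \sum_(l < n) sin (l.+1%:R * f) ^+ 2.
Proof.
move=> tt; apply: (@complexI R); rewrite -mul_adjmxE mxE rmorph_sum.
apply: eq_bigr => l _; rewrite !mxE /sinseq conjcM conjc_real.
rewrite mulrACA [conjc (t ^+ _)]rmorphXn -exprMn tt expr1n mul1r.
by rewrite -rmorphM expr2.
Qed.

(* Undoing the phases [t ^+ l] leaves a real vector and a real matrix, so [t x J x'] is real
   for the unshifted [J], and [svec_jordan] determines its real part. *)
Lemma mxform_svec n t f a : t * conjc t = 1 -> sin (n.+1%:R * f) = 0 ->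
  mxform (jordan_block n a) (svec n t f) (svec n t f) =
  (normsq (svec n t f))%:C%C * ((cos f)%:C%C * conjc t + a).
Proof.
move=> tt sinn.
have t0 : t != 0 by apply/eqP => t0; move/eqP: tt; rewrite t0 mul0r eq_sym oner_eq0.
have tV : t^-1 = conjc t by rewrite -[RHS](mulKf t0) tt mulr1.
set x := svec n t f; set J := jordan_block n a.
pose s := \sum_(l < n) sin (l.+1%:R * f) * sin (l%:R * f) : R.
have Es : t * mxform J x x = t * a * (normsq x)%:C%C + s%:C%C.
  rewrite /mxform /x /svec mul_jordan ?sinseq0 // mxE normsq_svec // !rmorph_sum /=.
  rewrite !mulr_sumr -big_split /=; apply: eq_bigr => l _.
  rewrite !mxE /sinseq conjcM conjc_real [conjc (t ^+ _)]rmorphXn /=.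
  have -> : t * ((a * (t ^+ l.+1 * (sin (l.+1%:R * f))%:C%C) + t ^+ l * (sin (l%:R * f))%:C%C) *
     (conjc t ^+ l.+1 * (sin (l.+1%:R * f))%:C%C)) =
     (t * conjc t) ^+ l.+1 * (t * a * ((sin (l.+1%:R * f))%:C%C * (sin (l.+1%:R * f))%:C%C)
       + (sin (l.+1%:R * f))%:C%C * (sin (l%:R * f))%:C%C).
    by rewrite exprMn !exprS; ring.
  by rewrite tt expr1n mul1r expr2 !rmorphM.
have := congr1 (fun y : 'rV_n => (y *m adjmx x) 0 0) (svec_jordan a t0 sinn).
rewrite -/x -/J mulmxDl -!scalemxAl [in LHS]mxE [X in X + _]mxE [X in _ + X]mxE.
rewrite -/(mxform J x x) -/(mxform (adjmx J) x x) [in RHS]mxE mul_adjmxE.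
rewrite -conjc_mxform tV -conjcM Es => E.
have E2 : s%:C%C = (cos f)%:C%C * (normsq x)%:C%C.
  have two_neq0 : (2 : C) != 0 by rewrite pnatr_eq0.
  apply: (mulfI two_neq0); move: E; rewrite conjcD !conjcM !conjc_real => E.
  transitivity (t * a * (normsq x)%:C%C + s%:C%C + (conjc t * conjc a * (normsq x)%:C%C + s%:C%C)
    - (t * a + conjc t * conjc a) * (normsq x)%:C%C); first by ring.
  by rewrite E; ring.
apply: (mulfI t0); rewrite Es E2.
transitivity (t * a * (normsq x)%:C%C + (t * conjc t) * (cos f)%:C%C * (normsq x)%:C%C); last
  by ring.
by rewrite tt mul1r.
Qed.

Lemma svec_neq0 n t k : t != 0 -> (0 < k <= n)%N -> svec n t (phi_ n k) != 0.
Proof.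
move=> t0 kn; apply/eqP => /rowP.
have n0 : (0 < n)%N by lia.
move=> /(_ (Ordinal n0)) /eqP; rewrite !mxE /sinseq mulf_eq0 mul1r (negPf t0) /=.
by rewrite eq_complex /= (gt_eqF (@sin_phi_gt0 R _ _ kn)).
Qed.
End Jordan.
(** * Outer bounds *)

Section Upper.
Variable R : realType.
Local Notation C := (complex R).

Lemma mxform_diag q (d : 'I_q -> R) (a : 'rV[C]_q) :
  mxform (diag_mx (\row_i (d i)%:C%C)) a a =
  (\sum_i d i * (complex.Re (a 0 i) ^+ 2 + complex.Im (a 0 i) ^+ 2))%:C%C.
Proof.
rewrite /mxform mul_mx_diag mxE rmorph_sum; apply: eq_bigr => i _; rewrite !mxE.
by case: (a 0 i) => x y; apply/eqP; rewrite eq_complex /=; apply/andP; split; apply/eqP; ring.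
Qed.

(** The indices run over [p, ..., n], hence [n.+1 - p] rows. *)
Definition svecs n (u : C) (p : nat) : 'M[C]_(n.+1 - p, n) :=
  \matrix_(i < n.+1 - p) svec n u (phi_ n (p + i)).

Lemma row_svecs n u p i : row i (svecs n u p) = svec n u (phi_ n (p + i)).
Proof. by rewrite rowK. Qed.

Lemma svecs_hermitian n u p (a : C) i : u * conjc u = 1 ->
  row i (svecs n u p) *m (u *: jordan_block n a + conjc u *: adjmx (jordan_block n a)) =
  (2 * (cos (phi_ n (p + i)) + complex.Re (u * a)))%:C%C *: row i (svecs n u p).
Proof.
move=> uu.
have u0 : u != 0 by apply/eqP => u0; move/eqP: uu; rewrite u0 mul0r eq_sym oner_eq0.
have uV : u^-1 = conjc u by rewrite -[RHS](mulKf u0) uu mulr1.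
rewrite row_svecs mulmxDr -!scalemxAr -uV svec_jordan ?sin_phi //; congr (_ *: _).
rewrite uV -addrA -conjcM addcJ rmorphM rmorph_nat rmorphD.
by ring.
Qed.

(** The eigenvalues [2 cos phi_j], obtained with [a = 0], are distinct. [0 < p] keeps out index 0,
    where the sine vector is zero. *)
Lemma svecs_row_free n u p : u * conjc u = 1 -> (0 < p)%N -> row_free (svecs n u p).
Proof.
move=> uu p0.
have u0 : u != 0 by apply/eqP => u0; move/eqP: uu; rewrite u0 mul0r eq_sym oner_eq0.
apply: (row_free_eigenrows (M := u *: jordan_block n 0 + conjc u *: adjmx (jordan_block n 0))
  (d := fun i => (2 * (cos (phi_ n (p + i)) + complex.Re (u * 0)))%:C%C)).
- have two0 : (2 : R) != 0 by rewrite pnatr_eq0.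
  move=> i j /complexI; rewrite mulr0 !addr0 => /(mulfI two0) cij.
  apply/eqP; move: cij; apply: contra_eqT => ij.
  have [lt|lt|/val_inj eqij] := ltngtP i j; last by rewrite eqij eqxx in ij.
  + rewrite gt_eqF //; apply: cos_phi_lt; first by lia.
    by have := ltn_ord j; lia.
  + rewrite lt_eqF //; apply: cos_phi_lt; first by lia.
    by have := ltn_ord i; lia.
- by move=> i; rewrite row_svecs svec_neq0 //; have := ltn_ord i; lia.
- by move=> i; rewrite svecs_hermitian.
Qed.

(** Eigenvectors of a Hermitian matrix for distinct eigenvalues are orthogonal. *)
Lemma svecs_gram n u p : u * conjc u = 1 ->
  svecs n u p *m adjmx (svecs n u p) = diag_mx (\row_i (normsq (row i (svecs n u p)))%:C%C).
Proof.
move=> uu; apply/matrixP => i j.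
have -> : (svecs n u p *m adjmx (svecs n u p)) i j =
   (row i (svecs n u p) *m adjmx (row j (svecs n u p))) 0 0.
  by rewrite !mxE; apply: eq_bigr => l _; rewrite !mxE.
rewrite [RHS]mxE [X in X *+ _]mxE -val_eqE; have [ij|ij] /= := eqVneq.
  by move/val_inj: ij => ->; rewrite -mul_adjmxE mulr1n.
rewrite mulr0n.
set x := row i _; set y := row j _; pose J := jordan_block n (0 : C).
pose H := u *: J + conjc u *: adjmx J.
have adjH : adjmx H = H.
  by rewrite /H adjmxD !adjmxZ adjmxK conjcK addrC.
have Hx := svecs_hermitian 0 i uu; have Hy := svecs_hermitian 0 j uu.
rewrite -/x -/y -/J -/H !mulr0 !addr0 in Hx Hy.
have E : (2 * cos (phi_ n (p + i)))%:C%C * (x *m adjmx y) 0 0 =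
         (2 * cos (phi_ n (p + j)))%:C%C * (x *m adjmx y) 0 0.
  transitivity (mxform H x y); first by rewrite /mxform Hx -scalemxAl [RHS]mxE.
  have -> : mxform H x y = (x *m adjmx (y *m H)) 0 0 by rewrite adjmxM adjH mulmxA.
  by rewrite Hy adjmxZ -scalemxAr [LHS]mxE conjc_real.
apply/eqP; move/eqP: E; rewrite -subr_eq0 -mulrBl mulf_eq0 => /orP[|//].
rewrite -rmorphB -mulrBr => /eqP/complexI/eqP; rewrite mulf_eq0 pnatr_eq0 /= subr_eq0 => cij.
suff : false by []; move: cij.
have [lt|lt|eqij] := ltngtP i j; last by move/eqP: ij; rewrite eqij.
+ rewrite gt_eqF //; apply: cos_phi_lt; first by lia.
  by have := ltn_ord j; lia.
+ rewrite lt_eqF //; apply: cos_phi_lt; first by lia.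
  by have := ltn_ord i; lia.
Qed.

(** Twice the real part is a Hermitian form that is diagonal in the orthogonal rows of [svecs]; its
    largest eigenvalue there belongs to index [p]. *)
Lemma Re_mxform_svecs n u p (a : C) (b : 'rV[C]_(n.+1 - p)) : u * conjc u = 1 ->
  complex.Re (u * mxform (jordan_block n a) (b *m svecs n u p) (b *m svecs n u p)) <=
  (cos (phi_ n p) + complex.Re (u * a)) * normsq (b *m svecs n u p).
Proof.
move=> uu; set V := svecs n u p; set y := b *m V; set J := jordan_block n a.
pose H := u *: J + conjc u *: adjmx J.
pose g i := normsq (row i V).
pose e (i : 'I_(n.+1 - p)) : R := cos (phi_ n (p + i)) + complex.Re (u * a).
have VH : V *m H = diag_mx (\row_i (2 * e i)%:C%C) *m V.
  apply/row_matrixP => i; rewrite row_mul svecs_hermitian // mul_diag_mx.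
  by apply/rowP => l; rewrite !mxE.
have normE : normsq y = \sum_i g i * (complex.Re (b 0 i) ^+ 2 + complex.Im (b 0 i) ^+ 2).
  apply: (@complexI R); rewrite -mul_adjmxE -mxform_diag -svecs_gram //.
  by rewrite /mxform adjmxM !mulmxA.
have HE : mxform H y y = (\sum_i (2 * e i * g i) * (complex.Re (b 0 i) ^+ 2 + complex.Im (b 0
  i) ^+ 2))%:C%C.
  rewrite -mxform_diag.
  have -> : diag_mx (\row_i (2 * e i * g i)%:C%C) = V *m H *m adjmx V.
    rewrite VH -mulmxA svecs_gram // mulmx_diag; congr diag_mx.
    by apply/rowP => i; rewrite !mxE rmorphM.
  by rewrite /mxform adjmxM !mulmxA.
have HR : mxform H y y = (2 * complex.Re (u * mxform J y y))%:C%C.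
  rewrite rmorphM rmorph_nat -addcJ conjcM conjc_mxform /mxform.
  by rewrite mulmxDr mulmxDl mxE -!scalemxAr -!scalemxAl !mxE.
rewrite -(ler_pM2l (_ : 0 < 2)) //; move: HR; rewrite HE => /complexI <-.
rewrite normE mulr_sumr mulr_sumr; apply: ler_sum => i _.
rewrite !mulrA ler_wpM2r ?addr_ge0 ?sqr_ge0 // ler_wpM2r ?normsq_ge0 //.
rewrite ler_pM2l // lerD2r cos_phi_le //; first by rewrite leq_addr.
by have := ltn_ord i; lia.
Qed.

Lemma Tmat_sub n m (al be lam : C) :
  Tmat n m al be - lam%:M = Tmat n m (- (lam - al)) (be - lam).
Proof.
rewrite /Tmat (scalar_mx_block n m lam) opp_block_mx add_block_mx !oppr0 !addr0 -raddfB.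
congr block_mx; apply/matrixP => i j; rewrite !mxE -val_eqE /= opprB.
by case: ifP; rewrite ?mulr1n ?mulr0n ?subr0.
Qed.

Lemma mxform_Tmat n m (al be : C) (x1 y1 : 'rV[C]_n) (x2 y2 : 'rV[C]_m) :
  mxform (Tmat n m al be) (row_mx x1 x2) (row_mx y1 y2) =
  mxform (jordan_block n al) x1 y1 + be * (x2 *m adjmx y2) 0 0.
Proof.
rewrite /mxform /Tmat mul_row_block !mulmx0 addr0 add0r adjmx_row_mx mul_row_col mxE.
by rewrite mul_mx_scalar -scalemxAl [X in _ + X]mxE.
Qed.

(** The sine vectors of index at least [k] together with [C^m] span [n + 1 - k + m] dimensions, just
    enough to meet the range of [P]. If the bound failed, the real part of [u] times the form would
    be negative at every nonzero vector of this span. *)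
Lemma numrange_halfplane n m k (al be lam u : C) : (0 < k <= n)%N ->
  rank_k_numrange k (Tmat n m al be) lam -> u * conjc u = 1 ->
  complex.Re (u * (lam - al)) <= Num.max (cos (phi_ n k)) (complex.Re (u * (be - al))).
Proof.
move=> /andP[k0 kn] Lk uu; rewrite leNgt; apply/negP => gt_max.
pose W := block_mx (svecs n u k) 0 0 (1%:M : 'M[C]_m).
have Wfree : row_free W.
  rewrite /row_free rank_diag_block_mx mxrank1.
  by have /eqP -> := svecs_row_free n uu k0.
have [|a a_neq0] := rank_k_numrangeE Lk Wfree; first by lia.
move: a_neq0; rewrite Tmat_sub -[a]hsubmxK; move: (lsubmx a) (rsubmx a) => b z.
rewrite mul_row_block !mulmx0 addr0 add0r mulmx1 mxform_Tmat mul_adjmxE => bz_neq0.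
move=> /(congr1 ( *%R u)); rewrite mulr0 mulrDr mulrA => /(congr1 (@complex.Re R)).
have ReD (x y : C) : complex.Re (x + y) = complex.Re x + complex.Re y by case: x; case: y.
have ReM (x : C) (y : R) : complex.Re (x * y%:C%C) = complex.Re x * y.
  by case: x => x1 x2; rewrite /= mulr0 subr0.
rewrite ReD ReM /= => E0.
have := @Re_mxform_svecs n u k (- (lam - al)) b uu.
have ReB : complex.Re (u * (be - lam)) = complex.Re (u * (be - al)) - complex.Re (u * (lam - al)).
  have -> : u * (be - lam) = u * (be - al) + - (u * (lam - al)) by ring.
  by rewrite ReD; case: (u * (lam - al)).
have ReN : complex.Re (u * - (lam - al)) = - complex.Re (u * (lam - al)).
  by rewrite mulrN; case: (u * (lam - al)).
rewrite ReN; rewrite ReB in E0.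
move: gt_max; rewrite gt_max => /andP[gt1 gt2].
have := normsq_ge0 (b *m svecs n u k); have := normsq_ge0 z.
set X := complex.Re (u * mxform _ _ _) in E0 *.
move: (normsq_eq0 (x := z)) (normsq_eq0 (x := b *m svecs n u k)).
move: (normsq _) (normsq _) E0 => p q E0 p0 q0 pge qge leX.
have [pe qe] : p = 0 /\ q = 0 by split; nra.
move: bz_neq0; rewrite (p0 qe).
move/eqP: (q0 pe); rewrite mulmx_free_eq0 ?svecs_row_free // => /eqP ->.
by rewrite row_mx0 eqxx.
Qed.

(** For [k > n] the summand [C^m] alone meets the range of [P], and [T - lam] acts on it as
    [be - lam]. *)
Lemma numrange_gtn n m k (al be lam : C) : (n < k)%N ->
  rank_k_numrange k (Tmat n m al be) lam -> lam = be.
Proof.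
move=> nk Lk; pose W := row_mx (0 : 'M_(m, n)) (1%:M : 'M[C]_m).
have Wfree : row_free W by rewrite /row_free rank_row_0mx mxrank1.
have [|a a_neq0] := rank_k_numrangeE Lk Wfree; first by lia.
rewrite Tmat_sub mul_mx_row mulmx0 mulmx1 mxform_Tmat mxform0l add0r mul_adjmxE.
move/eqP; rewrite mulf_eq0 subr_eq0 => /orP[/eqP -> //|/eqP/complexI/normsq_eq0/eqP].
by rewrite (negPf a_neq0).
Qed.

(** The sine vectors of index at least [k - m] have enough dimensions without [C^m], so [be] does
    not enter the bound. *)
Lemma numrange_disk n m k (al be lam u : C) : (m < k <= n + m)%N ->
  rank_k_numrange k (Tmat n m al be) lam -> u * conjc u = 1 ->
  complex.Re (u * (lam - al)) <= cos (phi_ n (k - m)).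
Proof.
move=> /andP[mk kn] Lk uu; rewrite leNgt; apply/negP => gt_c.
have k0 : (0 < k - m)%N by lia.
have Vfree := svecs_row_free n uu k0.
pose W := row_mx (svecs n u (k - m)) (0 : 'M[C]_(_, m)).
have Wfree : row_free W by rewrite /row_free rank_row_mx0.
have [|a a_neq0] := rank_k_numrangeE Lk Wfree; first by lia.
rewrite Tmat_sub mul_mx_row mulmx0 mxform_Tmat mul0mx [X in _ * X]mxE mulr0 addr0 => E0.
have := @Re_mxform_svecs n u (k - m) (- (lam - al)) a uu.
rewrite E0 mulr0 /=.
have -> : complex.Re (u * - (lam - al)) = - complex.Re (u * (lam - al)).
  by rewrite mulrN; case: (u * (lam - al)).
rewrite nmulr_rge0 ?subr_lt0 // => le0.
have /normsq_eq0/eqP : normsq (a *m svecs n u (k - m)) = 0.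
  by apply/le_anti; rewrite le0 normsq_ge0.
by rewrite mulmx_free_eq0 // (negPf a_neq0).
Qed.
End Upper.
(** * Neutral vectors *)

Section Lower.
Variable R : realType.
Local Notation C := (complex R).

Lemma adjmx_block m1 m2 n1 n2 (A : 'M[C]_(m1, n1)) (B : 'M[C]_(m1, n2))
    (A' : 'M[C]_(m2, n1)) (B' : 'M[C]_(m2, n2)) :
  adjmx (block_mx A B A' B') = block_mx (adjmx A) (adjmx A') (adjmx B) (adjmx B').
Proof. by rewrite /adjmx map_block_mx tr_block_mx. Qed.

Lemma adjmx_pid m n k : adjmx (pid_mx k : 'M[C]_(m, n)) = pid_mx k.
Proof. by rewrite /adjmx map_pid_mx tr_pid_mx. Qed.

(** The rows of [V] are neutral on their own; those of [M] are paired with orthonormal unit vectors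
    of [C^m], whose contribution [be - lam] cancels that of [M]. The identity block keeps the rows
    independent for any [M]. *)
Lemma numrange_block n m p q (al be lam : C) (V : 'M[C]_(p, n)) (M : 'M[C]_(q, n)) :
  let Q := jordan_block n (- (lam - al)) in
  (q <= m)%N -> row_free V ->
  (forall i j, mxform Q (row i V) (row j V) = 0) ->
  (forall i j, mxform Q (row i V) (row j M) = 0) ->
  (forall i j, mxform Q (row i M) (row j V) = 0) ->
  (forall i j, mxform Q (row i M) (row j M) = if i == j then - (be - lam) else 0) ->
  rank_k_numrange (p + q) (Tmat n m al be) lam.
Proof.
move=> Q qm Vfree VV VM MV MM.
have pid1 : pid_mx q *m adjmx (pid_mx q : 'M[C]_(q, m)) = 1%:M.
  by rewrite adjmx_pid mul_pid_mx minnn (minn_idPr qm) pid_mx_1.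
pose U := block_mx V 0 M (pid_mx q : 'M[C]_(q, m)).
apply: (@rank_k_numrangeI _ _ _ _ _ U).
  apply: inj_row_free => a; rewrite -[a]hsubmxK mul_row_block mulmx0 add0r -row_mx0.
  move=> /eq_row_mx[aV aP].
  have a2 : rsubmx a = 0 by rewrite -[LHS]mulmx1 -pid1 mulmxA aP mul0mx.
  move: aV; rewrite a2 mul0mx addr0 => /eqP; rewrite mulmx_free_eq0 // => /eqP->.
  by rewrite row_mx0.
rewrite Tmat_sub /Tmat -/Q /U adjmx_block !mulmx_block adjmx0.
rewrite !mulmx0 !mul0mx !add0r !addr0 !mul_mx_scalar -!scalemxAl ?mul0mx ?mulmx0 ?scaler0
  ?mul0mx ?addr0 pid1.
have z p1 p2 (A : 'M[C]_(p1, n)) (B : 'M[C]_(p2, n)) :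
    (forall i j, mxform Q (row i A) (row j B) = 0) -> A *m Q *m adjmx B = 0.
  by move=> AB; apply/matrixP => i j; rewrite mxform_rows AB mxE.
rewrite (z _ _ _ _ VV) (z _ _ _ _ VM) (z _ _ _ _ MV) -block_mx0; congr block_mx.
apply/matrixP => i j; rewrite mxE mxform_rows MM !mxE.
by case: eqP => _; rewrite ?mulr1n ?mulr0n ?mulr1 ?mulr0 ?addNr ?addr0.
Qed.

Lemma cmod_ge0 (z : C) : 0 <= cmod z.
Proof. exact: sqrtr_ge0. Qed.

Lemma sqr_cmod (z : C) : cmod z ^+ 2 = complex.Re z ^+ 2 + complex.Im z ^+ 2.
Proof. by rewrite sqr_sqrtr // addr_ge0 ?sqr_ge0. Qed.

Lemma mul_conjc (z : C) : z * conjc z = (cmod z ^+ 2)%:C%C.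
Proof.
rewrite sqr_cmod; case: z => x y.
by apply/eqP; rewrite eq_complex /=; apply/andP; split; apply/eqP; ring.
Qed.

Lemma cmod_gt0 (z : C) : z != 0 -> 0 < cmod z.
Proof.
move=> z0; rewrite lt_def cmod_ge0 andbT; apply: contra_neq z0 => cz0.
have /eqP := mul_conjc z; rewrite cz0 expr0n /= mulf_eq0 conjc_eq0 orbb.
by move/eqP.
Qed.

(* [s] is a root iff, with [t = (nu^* / r) s], the vector [svec t f] is an
   eigenvector of the pencil [(Q^*, Q)] for [Q = J - nu], [r = |nu|], [c = cos f]. *)
Definition root_at (r c : R) (s : C) : Prop :=
  s != 0 /\ r%:C%C * s ^+ 2 + r%:C%C = 2 * c%:C%C * s.

Lemma root_at_conj r c s : root_at r c s -> root_at r c (conjc s).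
Proof.
move=> [s0 E]; split; first by rewrite conjc_eq0.
have := congr1 (@conjc R) E.
by rewrite conjcD !conjcM !conjc_real conjc_nat.
Qed.

(** Squaring gives [4 c^2 s^2 = r^2 (s^2 + 1)^2], so [s^2] determines [c^2]. *)
Lemma root_at_sqr r c c' s s' : r != 0 -> root_at r c s -> root_at r c' s' ->
  s ^+ 2 = s' ^+ 2 -> c = c' \/ c = - c'.
Proof.
move=> r0 [s0 E] [s0' E'] ss.
have : ((c - c') * (c + c'))%:C%C = 0.
  rewrite rmorphM rmorphB rmorphD.
  have ss0 : s ^+ 2 != 0 by rewrite sqrf_eq0.
  apply: (mulfI ss0); apply: (mulfI (_ : (4 : C) != 0)); first by rewrite pnatr_eq0.
  rewrite !mulr0.
  transitivity ((2 * c%:C%C * s) ^+ 2 - (2 * c'%:C%C * s') ^+ 2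
     + 4 * c'%:C%C ^+ 2 * (s' ^+ 2 - s ^+ 2)); first by ring.
  by rewrite -E -E' ss; ring.
move=> /complexI/eqP; rewrite mulf_eq0 subr_eq0 addr_eq0 => /orP[/eqP ->|/eqP ->].
  by left.
by right.
Qed.

Lemma root_at_inv r c s : root_at r c s -> root_at r c s^-1.
Proof.
move=> [s0 E]; split; first by rewrite invr_eq0.
have sV0 : s ^+ 2 != 0 by rewrite sqrf_eq0.
apply: (mulfI sV0).
transitivity (r%:C%C * s ^+ 2 + r%:C%C); first by field.
by rewrite E; field.
Qed.

(** The last hypothesis says that [s] and the inverse conjugate of [s'] have the same square; roots
    are stable under conjugation and inversion. *)
Lemma root_at_ortho r c c' s s' : r != 0 -> root_at r c s -> root_at r c' s' ->
  (s * conjc s') ^+ 2 = 1 -> c = c' \/ c = - c'.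
Proof.
move=> r0 Es Es' ss; apply: (root_at_sqr r0 Es (root_at_inv (root_at_conj Es'))).
have [s0' _] := root_at_conj Es'.
by rewrite exprVn -[LHS]mulr1 -{1}(mulfV (_ : conjc s' ^+ 2 != 0)) ?sqrf_eq0 // mulrA -exprMn
  ss mul1r.
Qed.

(** [s^2 = 1] forces [c^2 = r^2], a double root, and [s^2 = -1] forces [c = 0]: the cases where
    [mxform_eig0] is silent on a real root paired with itself or a root paired with its
    conjugate. *)
Lemma root_at_pow4 r c s : r != 0 -> root_at r c s -> s ^+ 4 = 1 -> c = 0 \/ c ^+ 2 = r ^+ 2.
Proof.
move=> r0 Es s4; have [s0 E] := Es.
have [|] : s ^+ 2 = 1 \/ s ^+ 2 = -1.
- have : (s ^+ 2 - 1) * (s ^+ 2 + 1) = 0.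
    by transitivity (s ^+ 4 - 1); [ring|rewrite s4 subrr].
  by move/eqP; rewrite mulf_eq0 subr_eq0 addr_eq0 => /orP[/eqP ->|/eqP ->]; [left|right].
- move=> s2; right; apply: (@complexI R); rewrite !rmorphXn /=.
  apply: (mulfI (_ : (4 : C) != 0)); first by rewrite pnatr_eq0.
  transitivity ((2 * c%:C%C * s) ^+ 2).
    by rewrite !exprMn s2 mulr1; ring.
  by rewrite -E s2; ring.
move=> s2; left; apply: (@complexI R); apply: (mulIf s0).
apply: (mulfI (_ : (2 : C) != 0)); first by rewrite pnatr_eq0.
by rewrite mulrA -E s2 mul0r; ring.
Qed.

(** For [c >= 0], a root of [r s^2 - 2 c s + r]: the smaller real one if [r <= c], else the
    unimodular one in the upper half-plane. *)
Definition sroot (r c : R) : C :=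
  if r <= c then ((c - Num.sqrt (c ^+ 2 - r ^+ 2)) / r)%:C%C
  else Complex (c / r) (Num.sqrt (r ^+ 2 - c ^+ 2) / r).

Lemma sroot_real r c : 0 < r -> r <= c -> conjc (sroot r c) = sroot r c.
Proof. by move=> r0 rc; rewrite /sroot rc conjc_real. Qed.

Lemma sroot_unit r c : 0 < r -> 0 <= c <= r -> sroot r c * conjc (sroot r c) = 1.
Proof.
move=> r0 /andP[c0 cr]; rewrite /sroot; case: ifP => [rc|_].
  have -> : c = r by apply/le_anti; rewrite cr rc.
  by rewrite subrr sqrtr0 subr0 divff ?gt_eqF // conjc_real mulr1.
rewrite mul_conjc sqr_cmod /= !exprMn sqr_sqrtr; last by rewrite subr_ge0 ler_pXn2r ?nnegrE // ltW.
by rewrite -mulrDl addrC subrK exprVn divff ?expf_neq0 ?gt_eqF.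
Qed.

Lemma sroot_at r c : 0 < r -> 0 <= c -> root_at r c (sroot r c).
Proof.
move=> r0 c0; have r0' : r != 0 by rewrite gt_eqF.
have [rc|cr] := lerP r c.
  have rc2 : 0 <= c ^+ 2 - r ^+ 2 by rewrite subr_ge0 ler_pXn2r ?nnegrE // ltW.
  have sq := sqr_sqrtr rc2; have sge := sqrtr_ge0 (c ^+ 2 - r ^+ 2).
  rewrite /sroot rc; split.
    rewrite -(rmorph0 (real_complex R)) (inj_eq (@complexI R)) mulf_neq0 ?invr_eq0 //.
    by rewrite subr_eq0; apply/eqP => cs; move: sq; rewrite -cs => /eqP; rewrite -subr_eq0; nra.
  have -> : (2 : C) = (2 : R)%:C%C by rewrite rmorph_nat.
  rewrite -rmorphXn -!rmorphM -rmorphD /=; congr (_%:C%C).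
  set u := Num.sqrt _ in sq *.
  transitivity ((c ^+ 2 - 2 * c * u + u ^+ 2 + r ^+ 2) / r); first by field.
  by rewrite sq; field.
split.
  apply/eqP => s0; have := @sroot_unit r c r0; rewrite s0 mul0r c0 (ltW cr) => /(_ isT)/eqP.
  by rewrite eq_sym oner_eq0.
have rc2 : 0 <= r ^+ 2 - c ^+ 2 by rewrite subr_ge0 ler_pXn2r ?nnegrE // ltW.
have sq := sqr_sqrtr rc2.
rewrite /sroot leNgt cr /=; set u := Num.sqrt _ in sq *.
have two : (2 : C) = Complex 2 0 by rewrite -[LHS](rmorph_nat (real_complex R) 2).
rewrite two expr2; apply/eqP; rewrite eq_complex /=; apply/andP; split; apply/eqP.
  transitivity ((c ^+ 2 - u ^+ 2 + r ^+ 2) / r); first by field.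
  by rewrite sq; field.
by field.
Qed.

Section Vectors.
Variables (n : nat) (nu : C).
Hypothesis nu_neq0 : nu != 0.
Local Notation r := (cmod nu).
Local Notation Q := (jordan_block n (- nu)).

Let r_gt0 : 0 < r. Proof. exact: cmod_gt0. Qed.
Let r_neq0 : r != 0. Proof. by rewrite gt_eqF. Qed.
Let rC_neq0 : r%:C%C != 0 :> C.
Proof. by rewrite -(rmorph0 (real_complex R)) (inj_eq (@complexI R)). Qed.

(** With [t = tw s], [nu t^2 - 2 c t + nu'] becomes [(nu' / r) (r s^2 - 2 c s + r)], whose roots
    depend on [nu] only through [r]. *)
Definition tw (s : C) : C := conjc nu / r%:C%C * s.

Lemma tw_neq0 s : s != 0 -> tw s != 0.
Proof. by move=> s0; rewrite /tw !mulf_neq0 ?invr_eq0 ?conjc_eq0. Qed.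

Lemma tw_conj s s' : tw s * conjc (tw s') = s * conjc s'.
Proof.
rewrite /tw !conjcM conjcK conjc_inv conjc_real.
transitivity (nu * conjc nu * (s * conjc s') / r%:C%C ^+ 2); first by field.
by rewrite mul_conjc rmorphXn /=; field.
Qed.

Lemma svec_pencil j s : root_at r (cos (phi_ n j)) s ->
  svec n (tw s) (phi_ n j) *m adjmx Q =
  - tw s ^+ 2 *: (svec n (tw s) (phi_ n j) *m Q).
Proof.
move=> [s0 E]; apply: svec_jordan_adj; [exact: tw_neq0|exact: sin_phi|].
rewrite /tw conjcN.
transitivity (conjc nu / r%:C%C * (2 * (cos (phi_ n j))%:C%C * s)
   - conjc nu * ((nu * conjc nu) / r%:C%C ^+ 2 * s ^+ 2 + 1)); first by field.
by rewrite -E mul_conjc rmorphXn /=; field.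
Qed.

Lemma mxform_roots i j s s' : root_at r (cos (phi_ n i)) s -> root_at r (cos (phi_ n j)) s' ->
  (s * conjc s') ^+ 2 != 1 ->
  mxform Q (svec n (tw s) (phi_ n i)) (svec n (tw s') (phi_ n j)) = 0.
Proof.
move=> Es Es' ss; apply: mxform_eig0 (svec_pencil Es) (svec_pencil Es') _.
by rewrite conjcN mulrNN [conjc (_ ^+ 2)]rmorphXn -exprMn tw_conj.
Qed.

(** Otherwise [root_at_ortho] would make the cosines equal up to sign, but they are distinct and
    nonnegative. *)
Lemma mxform_roots_neq i j s s' : root_at r (cos (phi_ n i)) s -> root_at r (cos (phi_ n j)) s' ->
  0 <= cos (phi_ n i) :> R -> 0 <= cos (phi_ n j) :> R -> i != j -> (i <= n.+1)%N -> (j <=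
    n.+1)%N ->
  mxform Q (svec n (tw s) (phi_ n i)) (svec n (tw s') (phi_ n j)) = 0.
Proof.
move=> Es Es' ci cj ij i_le j_le; apply: mxform_roots => //; apply/eqP => /(root_at_ortho
  r_neq0 Es Es').
have : cos (phi_ n i) != cos (phi_ n j) :> R.
  move: ij; rewrite neq_ltn => /orP[lt|lt]; last by rewrite lt_eqF // cos_phi_lt.
  by rewrite gt_eqF // cos_phi_lt.
by move=> /eqP neq []; lra.
Qed.

(** For [r < c] the root is real with [s^4 != 1], and [mxform_eig0] applies. At the double root
    [r = c], where [s = 1], [mxform_svec] gives the factor [c t' - nu = 0]. *)
Lemma mxform_sroot j : (0 < j <= n)%N -> r <= cos (phi_ n j) ->
  mxform Q (svec n (tw (sroot r (cos (phi_ n j)))) (phi_ n j))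
           (svec n (tw (sroot r (cos (phi_ n j)))) (phi_ n j)) = 0.
Proof.
move=> j_n rc; set c := cos _ in rc *; have c0 : 0 <= c by apply: le_trans rc; exact: ltW.
have Es := sroot_at r_gt0 c0; have sR := sroot_real r_gt0 rc.
have [rc'|cr] := eqVneq r c.
  have s1 := @sroot_unit r c r_gt0; rewrite c0 -rc' lexx -tw_conj in s1.
  rewrite -rc' mxform_svec ?s1 ?sin_phi // -/c -rc'.
  have -> : sroot r r = 1.
    by rewrite /sroot lexx subrr sqrtr0 subr0 divff.
  rewrite /tw mulr1 conjcM conjcK conjc_inv conjc_real.
  have -> : r%:C%C * (nu * r%:C%C^-1) + - nu = 0 by field.
  by rewrite mulr0.
apply: mxform_roots => //; rewrite sR -expr2 -exprM.
apply/eqP => /(root_at_pow4 r_neq0 Es) [c_eq0|/eqP]; first by move: rc r_gt0; rewrite c_eq0 =>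
  ? ?; lra.
by rewrite eqrXn2 // ?ltW // eq_sym (negPf cr).
Qed.

Definition neutral p : 'M[C]_(p, n) :=
  \matrix_(i < p) svec n (tw (sroot r (cos (phi_ n i.+1)))) (phi_ n i.+1).

Lemma jordan_unit : Q \in unitmx.
Proof.
rewrite -unitmx_tr unitmxE det_trig; last first.
  by apply/is_trig_mxP => i j ij; rewrite !mxE; case: eqP; [lia|case: eqP; [lia|]].
rewrite unitfE prodf_seq_neq0; apply/allP => i _; rewrite !mxE eqxx oppr_eq0.
by apply/implyP.
Qed.

(** A relation [x Q' = mu (x Q)] makes [x] an eigenvector of [Q' Q^-1]. The eigenvalues [- t^2] are
    distinct by [root_at_sqr], the cosines being distinct and positive. *)
Lemma neutralP p : (p <= n)%N -> (forall i, (i < p)%N -> r <= cos (phi_ n i.+1)) ->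
  row_free (neutral p) /\ forall i j, mxform Q (row i (neutral p)) (row j (neutral p)) = 0.
Proof.
move=> pn rc.
have c0 i : (i < p)%N -> 0 <= cos (phi_ n i.+1) :> R.
  by move=> /rc; apply: le_trans; exact: ltW.
have Es (i : 'I_p) := sroot_at r_gt0 (c0 i (ltn_ord i)).
split.
  apply: (row_free_eigenrows (M := adjmx Q *m invmx Q)
     (d := fun i : 'I_p => - tw (sroot r (cos (phi_ n i.+1))) ^+ 2)).
  - move=> i j /oppr_inj; rewrite /tw !exprMn => /(mulfI _) ss.
    have {ss}/(root_at_sqr r_neq0 (Es i) (Es j)) cc : sroot r (cos (phi_ n i.+1)) ^+ 2 = sroot
      r (cos (phi_ n j.+1)) ^+ 2.
      by apply: ss; rewrite mulf_neq0 ?expf_neq0 ?invr_eq0 ?conjc_eq0.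
    apply/eqP; apply/negPn/negP => ij.
    have : cos (phi_ n i.+1) != cos (phi_ n j.+1) :> R.
      move: ij; rewrite -val_eqE neq_ltn /= => /orP[lt|lt].
        by rewrite gt_eqF // cos_phi_lt //; have := ltn_ord j; lia.
      by rewrite lt_eqF // cos_phi_lt //; have := ltn_ord i; lia.
    have := rc i (ltn_ord i); have := rc j (ltn_ord j); have := r_gt0.
    by move=> ? ? ? /eqP neq; case: cc; lra.
  - by move=> i; rewrite rowK svec_neq0 //; [have [s0 _] := Es i; exact: tw_neq0|have :=
    ltn_ord i; lia].
  - move=> i; rewrite rowK mulmxA (svec_pencil (Es i)) -scalemxAl mulmxK //.
    exact: jordan_unit.
move=> i j; rewrite !rowK; have [<-|ij] := eqVneq i j.
  by rewrite mxform_sroot ?rc //; have := ltn_ord i; lia.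
apply: mxform_roots_neq; [exact: Es|exact: Es|exact: c0|exact: c0| |  |].
- by rewrite eqSS.
- by have := ltn_ord i; lia.
- by have := ltn_ord j; lia.
Qed.
End Vectors.
End Lower.

(** * Points that lie in the numerical range *)

Section LowerBound.
Variable R : realType.
Local Notation C := (complex R).

Lemma mxform_lin2 n (A : 'M[C]_n) (v v' w w' : 'rV[C]_n) (x y z t : R) :
  mxform A (x%:C%C *: v + y%:C%C *: v') (z%:C%C *: w + t%:C%C *: w') =
  (x * z)%:C%C * mxform A v w + (x * t)%:C%C * mxform A v w' +
  ((y * z)%:C%C * mxform A v' w + (y * t)%:C%C * mxform A v' w').
Proof.
rewrite !mxformDl !mxformDr !mxformZl !mxformZr !conjc_real !rmorphM.
by rewrite !mulrA.
Qed.

(** The equations are linear in [x^2] and [y^2], with solutions [(A + B) / 2] and [(A - B) / 2],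
    nonnegative because [|b| S <= a c]. For [c = 0] the second one degenerates, [b = 0], and [y = 0]
    is chosen to remove the cross terms of the form. *)
Lemma conic_weights (r c S N a b : R) : 0 < r -> 0 <= c -> 0 < S -> 0 < N -> 0 <= a ->
  b ^+ 2 * S ^+ 2 <= a ^+ 2 * c ^+ 2 ->
  exists x y : R, [/\ x * y = 0 \/ c != 0,
    N * (S ^+ 2 / r ^+ 2 * (x ^+ 2 + y ^+ 2)) = a &
    N * (c * S / r ^+ 2 * (x ^+ 2 - y ^+ 2)) = b].
Proof.
move=> r0 c0 S0 N0 a0 abc; have r_neq0 : r != 0 by rewrite gt_eqF.
have ex_sqrt (X : R) : 0 <= X -> exists x, x ^+ 2 = X.
  by move=> X0; exists (Num.sqrt X); rewrite sqr_sqrtr.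
have [c_eq0|c_neq0] := eqVneq c 0.
  have b0 : b = 0.
    have : b ^+ 2 * S ^+ 2 <= 0 by move: abc; rewrite c_eq0 expr0n mulr0.
    rewrite -exprMn => bS_le0; have : (b * S) ^+ 2 == 0 by rewrite eq_le bS_le0 sqr_ge0.
    by rewrite sqrf_eq0 mulf_eq0 (gt_eqF S0) orbF => /eqP.
  have [|x xE] := ex_sqrt (a / (N * (S ^+ 2 / r ^+ 2))).
    by rewrite divr_ge0 // mulr_ge0 ?(ltW N0) // divr_ge0 ?sqr_ge0.
  exists x, 0; split; first by left; rewrite mulr0.
    by rewrite expr0n addr0 xE; field; rewrite r_neq0 !gt_eqF.
  by rewrite c_eq0 b0 !mul0r mulr0.
have cpos : 0 < c by rewrite lt_def c_neq0.
pose A := a * r ^+ 2 / (N * S ^+ 2); pose B := b * r ^+ 2 / (N * c * S).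
have AB : `|b| * S <= a * c.
  rewrite -(@ler_pXn2r _ 2) ?nnegrE ?(mulr_ge0 (normr_ge0 _) (ltW S0)) ?(mulr_ge0 a0 c0) //.
  by rewrite !exprMn -normrX ger0_norm ?sqr_ge0.
have AB1 : b * S <= a * c by apply: le_trans AB; rewrite ler_wpM2r ?ler_norm ?(ltW S0).
have AB2 : - b * S <= a * c by apply: le_trans AB; rewrite -normrN ler_wpM2r ?ler_norm ?(ltW S0).
have k0 : 0 <= r ^+ 2 / (N * S ^+ 2 * c).
  by rewrite divr_ge0 ?sqr_ge0 // mulr_ge0 // mulr_ge0 ?sqr_ge0 // ltW.
have subAB : 0 <= A - B.
  have -> : A - B = (a * c - b * S) * (r ^+ 2 / (N * S ^+ 2 * c)).
    by rewrite /A /B; field; rewrite !gt_eqF.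
  by rewrite mulr_ge0 ?subr_ge0.
have addAB : 0 <= A + B.
  have -> : A + B = (a * c - - b * S) * (r ^+ 2 / (N * S ^+ 2 * c)).
    by rewrite /A /B; field; rewrite !gt_eqF.
  by rewrite mulr_ge0 ?subr_ge0.
have [|x xE] := ex_sqrt ((A + B) / 2); first by rewrite divr_ge0.
have [|y yE] := ex_sqrt ((A - B) / 2); first by rewrite divr_ge0.
exists x, y; rewrite xE yE /A /B; split; first by right.
- by field; rewrite r_neq0 !gt_eqF.
- by field; rewrite r_neq0 !gt_eqF.
Qed.

Section Mix.
Variables (n : nat) (nu : C).
Hypothesis nu_neq0 : nu != 0.
Local Notation r := (cmod nu).
Local Notation Q := (jordan_block n (- nu)).

(** Weights [(1, 0)] recover a row of [neutral], so [mixv_ortho] serves both kinds of rows. *)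
Definition mixv j (x : R * R) : 'rV[C]_n :=
  let c := cos (phi_ n j) in
  x.1%:C%C *: svec n (tw nu (sroot r c)) (phi_ n j) +
  x.2%:C%C *: svec n (tw nu (conjc (sroot r c))) (phi_ n j).

Lemma mixv_ortho i j x y :
  0 <= cos (phi_ n i) :> R -> 0 <= cos (phi_ n j) :> R -> i != j ->
  (i <= n.+1)%N -> (j <= n.+1)%N -> mxform Q (mixv i x) (mixv j y) = 0.
Proof.
move=> ci cj ij i_le j_le; have r0 := cmod_gt0 nu_neq0.
have Ei := sroot_at r0 ci; have Ej := sroot_at r0 cj.
have Ei' := root_at_conj Ei; have Ej' := root_at_conj Ej.
have z s s' Es Es' := @mxform_roots_neq _ _ _ nu_neq0 i j s s' Es Es' ci cj ij i_le j_le.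
by rewrite /mixv mxform_lin2 !z // !mulr0 !addr0.
Qed.

(** [a + i b] stands for [(be - lam) / nu]. Up to the factor [- nu], the values at the two vectors
    span the cone [|b| S <= a c] with [S^2 = r^2 - c^2]. The cross terms vanish by [root_at_pow4] if
    [c != 0], and through [x y = 0] otherwise. *)
Lemma mixv_diag j (a b : R) : (0 < j <= n)%N -> 0 <= (cos (phi_ n j) : R) < r -> 0 <= a ->
  b ^+ 2 * (r ^+ 2 - cos (phi_ n j) ^+ 2) <= a ^+ 2 * cos (phi_ n j) ^+ 2 ->
  exists x, mxform Q (mixv j x) (mixv j x) = - (nu * Complex a b).
Proof.
rewrite /mixv => jn /andP[c0 cr] a0 abc.
have r0 := cmod_gt0 nu_neq0; have r_neq0 : r != 0 by rewrite gt_eqF.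
have rC : r%:C%C != 0 :> C by rewrite -(rmorph0 (real_complex R)) (inj_eq (@complexI R)).
have S2pos : 0 < r ^+ 2 - cos (phi_ n j) ^+ 2 by rewrite subr_gt0 ltr_pXn2r ?nnegrE // ltW.
have [S [S0 S2 sE]] : exists S : R, [/\ 0 < S, S ^+ 2 = r ^+ 2 - cos (phi_ n j) ^+ 2 &
    sroot r (cos (phi_ n j)) = Complex (cos (phi_ n j) / r) (S / r)].
  exists (Num.sqrt (r ^+ 2 - cos (phi_ n j) ^+ 2)); split; first by rewrite sqrtr_gt0.
    by rewrite sqr_sqrtr // ltW.
  by rewrite /sroot leNgt cr.
have ss := @sroot_unit _ r (cos (phi_ n j)) r0; rewrite c0 (ltW cr) in ss.
have {ss}ss := ss isT.
have Es := sroot_at r0 c0.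
move: (sroot _ _) Es ss sE => s Es ss sE.
have Es' := root_at_conj Es; have [s0 _] := Es; have [s0' _] := Es'.
have tt : tw nu s * conjc (tw nu s) = 1 by rewrite tw_conj.
have tt' : tw nu (conjc s) * conjc (tw nu (conjc s)) = 1 by rewrite tw_conj // conjcK mulrC.
have qE := mxform_svec (- nu) tt (sin_phi R n j).
have qE' := mxform_svec (- nu) tt' (sin_phi R n j).
have vN : normsq (svec n (tw nu (conjc s)) (phi_ n j)) = normsq (svec n (tw nu s) (phi_ n j)).
  by rewrite !normsq_svec.
have N0 : 0 < normsq (svec n (tw nu s) (phi_ n j)).
  rewrite lt_def normsq_ge0 andbT; apply/eqP => /normsq_eq0/eqP; apply/negP.
  by apply: svec_neq0 => //; exact: tw_neq0.
have cross : cos (phi_ n j) != 0 :> R ->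
    mxform Q (svec n (tw nu s) (phi_ n j)) (svec n (tw nu (conjc s)) (phi_ n j)) = 0 /\
    mxform Q (svec n (tw nu (conjc s)) (phi_ n j)) (svec n (tw nu s) (phi_ n j)) = 0.
  move=> c_neq0.
  have no4 (z : C) : root_at r (cos (phi_ n j)) z -> (z ^+ 2) ^+ 2 != 1.
    move=> Ez; rewrite -exprM; apply/eqP => /(root_at_pow4 r_neq0 Ez) [/eqP|cr2].
      by rewrite (negPf c_neq0).
    by move: S2pos; rewrite cr2 subrr ltxx.
  split; apply: mxform_roots => //; first by rewrite conjcK -expr2 no4.
  by rewrite -expr2 no4.
rewrite -S2 in abc.
have [x [y [xyc xa yb]]] := conic_weights r0 c0 S0 N0 a0 abc.
exists (x, y); rewrite /= mxform_lin2.
have -> : (x * y)%:C%C * mxform Q (svec n (tw nu s) (phi_ n j)) (svec n (tw nu (conjc s)) (phi_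
  n j)) = 0.
  by case: xyc => [->|/cross[-> _]]; rewrite ?mul0r ?mulr0.
have -> : (y * x)%:C%C * mxform Q (svec n (tw nu (conjc s)) (phi_ n j)) (svec n (tw nu s) (phi_
  n j)) = 0.
  by rewrite (mulrC y); case: xyc => [->|/cross[_ ->]]; rewrite ?mul0r ?mulr0.
rewrite addr0 add0r qE qE' vN {qE qE' vN tt tt' cross Es Es'}.
move: (normsq _) N0 xa yb => N N0 xa yb.
move: (cos _) c0 cr abc S2 S2pos sE xyc xa yb => c c0 cr abc S2 S2pos sE xyc xa yb.
(* For [t = tw s], [mxform_svec] gives [N (c t' - nu) = - nu N (1 - c s' / r)]; the last factor has
   the real and imaginary parts used in [conic_weights]. *)
have key : N%:C%C * ((x * x)%:C%C * (1 - c%:C%C * conjc s / r%:C%C)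
    + (y * y)%:C%C * (1 - c%:C%C * s / r%:C%C)) = Complex a b.
  rewrite -xa -yb sE -!fmorphV /=; move: r r_neq0 S2 => t t0 S2.
  apply/eqP; rewrite eq_complex /=; apply/andP; split; apply/eqP.
    by rewrite S2; field.
  by field.
rewrite -key /tw !conjcM !conjcK conjc_inv conjc_real.
by field.
Qed.

Lemma row_neutral p (i : 'I_p) : row i (neutral n nu p) = mixv i.+1 (1, 0).
Proof. by rewrite rowK /mixv /= scale1r scale0r addr0. Qed.
End Mix.

(** Indices [1, ..., p] give neutral vectors; each of [p + 1, ..., p + q] is combined with its own
    unit vector of [C^m]. The cone condition is imposed at the last index, whose cosine is smallest
    and cone narrowest. *)
Lemma numrange_mem n m p q (al be lam : C) (a b : R) :
  lam - al != 0 -> (0 < n)%N -> (q <= m)%N -> ((p + q).*2 <= n.+1)%N ->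
  (forall i, (i < p)%N -> cmod (lam - al) <= cos (phi_ n i.+1)) ->
  (forall i, (p <= i < p + q)%N -> cos (phi_ n i.+1) < cmod (lam - al)) ->
  be - lam = (lam - al) * Complex a b -> 0 <= a ->
  b ^+ 2 * (cmod (lam - al) ^+ 2 - cos (phi_ n (p + q)) ^+ 2) <= a ^+ 2 * cos (phi_ n (p + q))
    ^+ 2 ->
  rank_k_numrange (p + q) (Tmat n m al be) lam.
Proof.
move=> nu0 n0 qm pqn rc cr ab a0 abc.
have cpq : 0 <= cos (phi_ n (p + q)) :> R.
  have [le|le] := leqP (p + q).*2 n; first exact/ltW/cos_phi_gt0.
  by rewrite cos_phi_half //; lia.
have c_le (i : nat) : (i < p + q)%N -> cos (phi_ n (p + q)) <= cos (phi_ n i.+1) :> R.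
  by move=> i_lt; apply: cos_phi_le => //; lia.
have c0 (i : nat) : (i < p + q)%N -> 0 <= cos (phi_ n i.+1) :> R.
  by move=> /c_le; exact: le_trans.
have pn : (p <= n)%N by lia.
have [Vfree V0] := neutralP nu0 pn rc.
have xP (i : 'I_q) : exists x,
    mxform (jordan_block n (- (lam - al))) (mixv n (lam - al) (p + i).+1 x) (mixv n (lam - al)
      (p + i).+1 x)
    = - (be - lam).
  rewrite ab; apply: mixv_diag => //.
  - by have := ltn_ord i; lia.
  - rewrite c0 ?cr //; have := ltn_ord i; lia.
  - have lt_i : (p + i < p + q)%N by rewrite ltn_add2l.
    have cc : cos (phi_ n (p + q)) ^+ 2 <= cos (phi_ n (p + i).+1) ^+ 2 :> R.
      by rewrite ler_pXn2r ?nnegrE ?c0 ?c_le.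
    apply: le_trans (_ : b ^+ 2 * (cmod (lam - al) ^+ 2 - cos (phi_ n (p + q)) ^+ 2) <= _).
      by rewrite ler_wpM2l ?sqr_ge0 // lerB.
    by apply: le_trans abc _; rewrite ler_wpM2l ?sqr_ge0.
have {xP}[x xP] := fin_all_exists xP.
apply: (@numrange_block _ _ _ _ _ _ _ _ (neutral n (lam - al) p)
  (\matrix_(i < q) mixv n (lam - al) (p + i).+1 (x i))) => //.
- move=> i j; rewrite row_neutral rowK mixv_ortho ?c0 ?ltn_add2l //.
  + by have := ltn_ord i; lia.
  + by have := ltn_ord i; lia.
  + by have := ltn_ord i; lia.
  + by have := ltn_ord j; lia.
- move=> i j; rewrite row_neutral rowK mixv_ortho ?c0 ?ltn_add2l //.
  + by have := ltn_ord j; lia.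
  + by have := ltn_ord j; lia.
  + by have := ltn_ord i; lia.
  + by have := ltn_ord j; lia.
move=> i j; rewrite !rowK; have [<-|ij] := eqVneq i j; first exact: xP.
rewrite mixv_ortho ?c0 ?ltn_add2l //.
- by move: ij; rewrite -val_eqE /= eqSS eqn_add2l.
- by have := ltn_ord i; lia.
- by have := ltn_ord j; lia.
Qed.

(** At [lam = be] the unit vectors of [C^m] are themselves neutral, so [M = 0] serves. *)
Lemma numrange_mem_eigen n m p q (al be : C) :
  be - al != 0 -> (p <= n)%N -> (q <= m)%N ->
  (forall i, (i < p)%N -> cmod (be - al) <= cos (phi_ n i.+1)) ->
  rank_k_numrange (p + q) (Tmat n m al be) be.
Proof.
move=> nu0 pn qm rc; have [Vfree V0] := neutralP nu0 pn rc.
apply: (@numrange_block _ _ _ _ _ _ _ _ (neutral n (be - al) p) 0) => // i j.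
- by rewrite row0 mxform0r.
- by rewrite row0 mxform0l.
- by rewrite !row0 mxform0l subrr oppr0; case: eqP.
Qed.

(** At [lam = al] the block is nilpotent and links only consecutive basis vectors, so those at
    positions [0, 2, 4, ...] are pairwise neutral. They replace the sine vectors, since [tw]
    degenerates at [nu = 0]. *)
Lemma numrange_mem0 n m p q (al be : C) :
  (p.*2 <= n.+1)%N -> (q <= m)%N -> (q = 0)%N \/ be = al ->
  rank_k_numrange (p + q) (Tmat n m al be) al.
Proof.
move=> pn qm q0.
have lt_n (i : 'I_p) : (i.*2 < n)%N by have := ltn_ord i; lia.
pose V : 'M[C]_(p, n) := \matrix_(i < p) delta_mx 0 (Ordinal (lt_n i)).
have adj_delta (l : 'I_n) : adjmx (delta_mx 0 l : 'rV[C]_n) = delta_mx l 0.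
  by rewrite /adjmx map_delta_mx trmx_delta.
apply: (@numrange_block _ _ _ _ _ _ _ _ V 0) => //.
- apply: inj_row_free => v /rowP vV; apply/rowP => i; have := vV (Ordinal (lt_n i)).
  rewrite !mxE (bigD1 i) //= !mxE !eqxx mulr1 big1 ?addr0 // => j ij.
  have /negPf ij2 : Ordinal (lt_n i) != Ordinal (lt_n j).
    by apply: contraNneq ij => -[ij2]; apply/eqP/val_inj => /=; lia.
  by rewrite !mxE ij2 andbF mulr0.
- move=> i j; rewrite !rowK /mxform adj_delta -rowE -colE !mxE /= subrr oppr0.
  by case: eqP => // _; case: eqP => //; lia.
- by move=> i j; rewrite row0 mxform0r.
- by move=> i j; rewrite row0 mxform0l.
- move=> i j; rewrite !row0 mxform0l; case: q0 => [q0|->]; first by exfalso; have := ltn_ord i; lia.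
  by rewrite subrr oppr0; case: eqP.
Qed.
End LowerBound.
(** * Planar geometry *)

Section Plane.
Variable R : realType.
Local Notation C := (complex R).

Lemma cmod_sqrt (x y : R) : cmod (Complex x y) = Num.sqrt (x ^+ 2 + y ^+ 2).
Proof. by []. Qed.

Lemma sqr_cmodE (x y : R) : cmod (Complex x y) ^+ 2 = x ^+ 2 + y ^+ 2.
Proof. exact: sqr_cmod. Qed.

Lemma cmodM (z w : C) : cmod (z * w) = cmod z * cmod w.
Proof.
apply/eqP; rewrite -(@eqrXn2 _ 2) ?mulr_ge0 ?cmod_ge0 // exprMn !sqr_cmod.
by case: z w => [a b] [c e] /=; apply/eqP; ring.
Qed.

Lemma cmod_expi (t : R) : cmod (expi t) = 1.
Proof. by rewrite /expi cmod_sqrt cos2Dsin2 sqrtr1. Qed.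

Lemma expi_conj (t : R) : expi t * conjc (expi t) = 1.
Proof. by rewrite mul_conjc cmod_expi expr1n. Qed.

Lemma expi_neq0 (t : R) : expi t != 0.
Proof. by apply/eqP => t0; have /eqP := expi_conj t; rewrite t0 mul0r eq_sym oner_eq0. Qed.

Lemma polar (x y : R) : exists t, Complex x y = (cmod (Complex x y))%:C%C * expi t.
Proof.
set r := cmod _; have r_ge0 : 0 <= r by exact: cmod_ge0.
have r2 : r ^+ 2 = x ^+ 2 + y ^+ 2 by exact: sqr_cmodE.
have [r0|r_neq0] := eqVneq r 0.
  exists 0; move/eqP: r2; rewrite r0 expr0n /= eq_sym paddr_eq0 ?sqr_ge0 // !sqrf_eq0.
  by move=> /andP[/eqP-> /eqP->]; rewrite mul0r.
have r_gt0 : 0 < r by rewrite lt_def r_neq0.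
have xr : -1 <= x / r <= 1.
  by rewrite -ler_norml normrM normfV (gtr0_norm r_gt0) ler_pdivrMr // mul1r
    -(@ler_pXn2r _ 2) ?nnegrE // real_normK ?num_real // r2 lerDl sqr_ge0.
have cosE : cos (acos (x / r)) = x / r by apply: acosK; rewrite in_itv.
have sinE : sin (acos (x / r)) = `|y| / r.
  rewrite sin_acos // expr_div_n r2.
  have -> : 1 - x ^+ 2 / (x ^+ 2 + y ^+ 2) = (`|y| / r) ^+ 2.
    rewrite expr_div_n real_normK ?num_real // r2; field.
    by rewrite -r2 sqrf_eq0.
  by rewrite sqrtr_sqr ger0_norm // divr_ge0.
have [y_ge0|y_lt0] := lerP 0 y.
  exists (acos (x / r)); rewrite /expi cosE sinE ger0_norm //.
  apply/eqP; rewrite eq_complex /=; apply/andP; split; apply/eqP.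
    by rewrite mul0r subr0 mulrC divfK.
  by rewrite mul0r addr0 mulrC divfK.
exists (- acos (x / r)); rewrite /expi cosN sinN cosE sinE ltr0_norm //.
apply/eqP; rewrite eq_complex /=; apply/andP; split; apply/eqP.
  by rewrite mul0r subr0 mulrC divfK.
by rewrite mul0r addr0 mulNr opprK mulrC divfK.
Qed.

(** The inequality is tested in the direction of the point itself. *)
Lemma cmod_support (x y c : R) :
  (forall s t : R, s ^+ 2 + t ^+ 2 = 1 -> x * s + y * t <= c) -> cmod (Complex x y) <= c.
Proof.
move=> H; have [t E] := polar x y.
have := H (cos t) (sin t) (cos2Dsin2 t); move: E; set r := cmod _ => -[-> ->].
rewrite !mul0r subr0 addr0 -!mulrA -mulrDr -!expr2 cos2Dsin2 mulr1.
by [].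
Qed.

(* The tangent cone from [d] to the circle of radius [c], cut by the sector,
   turned into the condition of [numrange_mem]. *)
Lemma tangent_cone (c d r x y : R) : 0 < c -> c < d -> c < r -> r ^+ 2 = x ^+ 2 + y ^+ 2 ->
  x <= d -> c * r < d * x -> y ^+ 2 * (d ^+ 2 - c ^+ 2) <= (d - x) ^+ 2 * c ^+ 2 ->
  r ^+ 2 <= d * x /\ (d * y) ^+ 2 * (r ^+ 2 - c ^+ 2) <= (d * x - r ^+ 2) ^+ 2 * c ^+ 2.
Proof.
move=> c0 cd cr r2 xd crdx ydc.
have d0 : 0 < d by exact: lt_trans cd.
have r0 : 0 < r by exact: lt_trans cr.
have cc : c ^+ 2 < d * x by apply: le_lt_trans crdx; rewrite expr2 ler_pM2l // ltW.
have dc : 0 < d ^+ 2 - c ^+ 2 by rewrite subr_gt0 ltr_pXn2r ?nnegrE // ltW.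
split.
  (* [r^2 <= d x] is the disk with diameter from [0] to [d]. Outside it, the cone condition would
     give [d x < c^2], against [cc]. *)
  rewrite leNgt; apply/negP => dxr.
  have yx : x * (d - x) < y ^+ 2 by move: dxr; rewrite r2; nra.
  have [xd'|xd'] := eqVneq x d.
    move: ydc yx; rewrite xd' subrr expr0n /= mul0r mulr0 => ydc yx.
    by have := mulr_gt0 yx dc; rewrite ltNge ydc.
  have dx : 0 < d - x by rewrite subr_gt0 lt_neqAle xd' xd.
  have : (d - x) * (x * (d ^+ 2 - c ^+ 2)) < (d - x) * ((d - x) * c ^+ 2).
    apply: lt_le_trans (_ : y ^+ 2 * (d ^+ 2 - c ^+ 2) <= _).
      by rewrite mulrA (mulrC (d - x)) ltr_pM2r.
    by apply: le_trans ydc _; rewrite mulrA -expr2.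
  rewrite ltr_pM2l // => lt.
  have : d * (d * x) < d * c ^+ 2 by move: lt; nra.
  by rewrite ltr_pM2l // => /(lt_trans cc); rewrite ltxx.
(* The cone condition restated: unless the points coincide, the line joining [(x, y)] to [(d, 0)]
   passes within [c] of the origin. *)
have yd : d ^+ 2 * y ^+ 2 <= c ^+ 2 * ((d - x) ^+ 2 + y ^+ 2) by move: ydc; nra.
rewrite -subr_ge0.
have -> : (d * x - r ^+ 2) ^+ 2 * c ^+ 2 - (d * y) ^+ 2 * (r ^+ 2 - c ^+ 2) =
  r ^+ 2 * (c ^+ 2 * ((d - x) ^+ 2 + y ^+ 2) - d ^+ 2 * y ^+ 2) by rewrite r2; ring.
by rewrite mulr_ge0 ?sqr_ge0 // subr_ge0.
Qed.

Lemma threshold (f : nat -> R) (r : R) k :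
  (forall i j, (i <= j < k)%N -> f j <= f i) ->
  exists p, [/\ (p <= k)%N, forall i, (i < p)%N -> r <= f i &
                forall i, (p <= i < k)%N -> f i < r].
Proof.
elim: k => [|k IHk] f_dec; first by exists 0; split => // i; lia.
have [|p [pk le_p lt_p]] := IHk; first by move=> i j ij; apply: f_dec; lia.
have [rk|kr] := lerP r (f k).
  exists k.+1; split => // i i_lt; last by lia.
  by apply: le_trans rk _; apply: f_dec; lia.
exists p; split => // [|i i_itv]; first by lia.
by have [->//|ik] := eqVneq i k; apply: lt_p; lia.
Qed.
End Plane.

(** * The seven cases in coordinates with [al] at the origin and [be] at [(d, 0)] *)

Section Coordinates.
Variables (R : realType) (n m : nat) (al be : complex R) (ps : R) (k : nat).
Hypothesis n_gt0 : (0 < n)%N.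
Hypothesis k_itv : (1 <= k <= n + m)%N.
Local Notation d := (cmod (be - al)).
Hypothesis be_polar : be - al = d%:C%C * expi ps.
Local Notation C := (complex R).
Local Notation L := (rank_k_numrange k (Tmat n m al be)).
Local Notation c_ j := (cos (phi_ n j) : R).

Definition pt (x y : R) : C := al + expi ps * Complex x y.

Lemma ptP lam : exists x y, lam = pt x y.
Proof.
case E : (conjc (expi ps) * (lam - al)) => [x y]; exists x, y.
by rewrite /pt -E mulrA expi_conj mul1r addrC subrK.
Qed.

Lemma pt_sub x y : pt x y - al = expi ps * Complex x y.
Proof. by rewrite /pt addrC addKr. Qed.

Lemma cmod_pt x y : cmod (pt x y - al) = cmod (Complex x y).
Proof. by rewrite pt_sub cmodM cmod_expi mul1r. Qed.

Lemma rot_shift_pt (S : set C) x y : rot_shift al ps S (pt x y) <-> S (Complex x y).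
Proof.
split=> [[w Sw /addrI/(mulfI (expi_neq0 _)) ->] //|Sxy].
by exists (Complex x y).
Qed.

Lemma be_pt : be = pt d 0.
Proof. by rewrite /pt -[RHS]/(al + expi ps * d%:C%C) mulrC -be_polar addrC subrK. Qed.

Lemma d_ge0 : 0 <= d. Proof. exact: cmod_ge0. Qed.

(** Take [u = exp (- i ps) (s - i t)], for which [Re (u (lam - al)) = x s + y t]. *)
Lemma pt_halfplane x y s t : (k <= n)%N -> L (pt x y) -> s ^+ 2 + t ^+ 2 = 1 ->
  x * s + y * t <= Num.max (c_ k) (d * s).
Proof.
move=> kn Lxy st; have kn' : (0 < k <= n)%N by lia.
have uu : (conjc (expi ps) * Complex s (- t)) * conjc (conjc (expi ps) * Complex s (- t)) = 1.
  rewrite conjcM conjcK mulrACA [conjc _ * _]mulrC expi_conj mul1r mul_conjc sqr_cmodE sqrrN st.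
  by [].
have := numrange_halfplane kn' Lxy uu.
rewrite pt_sub be_polar.
have -> : conjc (expi ps) * Complex s (- t) * (expi ps * Complex x y) =
  (expi ps * conjc (expi ps)) * (Complex s (- t) * Complex x y) by ring.
have -> : conjc (expi ps) * Complex s (- t) * (d%:C%C * expi ps) =
  (expi ps * conjc (expi ps)) * (Complex s (- t) * d%:C%C) by ring.
rewrite expi_conj !mul1r -be_polar /= mulr0 subr0 mulNr opprK.
by rewrite (mulrC s x) (mulrC t y) (mulrC s d).
Qed.

Lemma pt_disk x y : (m < k)%N -> L (pt x y) -> cmod (Complex x y) <= c_ (k - m).
Proof.
move=> mk Lxy; have mk' : (m < k <= n + m)%N by lia.
apply: cmod_support => s t st.
have uu : (conjc (expi ps) * Complex s (- t)) * conjc (conjc (expi ps) * Complex s (- t)) = 1.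
  rewrite conjcM conjcK mulrACA [conjc _ * _]mulrC expi_conj mul1r mul_conjc sqr_cmodE sqrrN st.
  by [].
have := numrange_disk mk' Lxy uu; rewrite pt_sub.
have -> : conjc (expi ps) * Complex s (- t) * (expi ps * Complex x y) =
  (expi ps * conjc (expi ps)) * (Complex s (- t) * Complex x y) by ring.
rewrite expi_conj !mul1r /= mulNr opprK.
by rewrite (mulrC s x) (mulrC t y).
Qed.

Lemma pt_mem_origin : (k.*2 <= n.+1)%N -> L (pt 0 0).
Proof.
move=> kn; have -> : pt 0 0 = al by rewrite /pt mulr0 addr0.
by rewrite -[k]addn0; apply: numrange_mem0 => //; left.
Qed.

(** Every index up to [k] has a cosine at least [|nu|], so there are [k] neutral vectors. The centre
    is left to [pt_mem_origin]. *)
Lemma pt_mem_disk x y : (k.*2 <= n)%N -> cmod (Complex x y) <= c_ k -> L (pt x y).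
Proof.
move=> kn xy; have [E|xy0] := eqVneq (Complex x y) 0.
  by case: E => -> ->; apply: pt_mem_origin; lia.
have nu0 : pt x y - al != 0 by rewrite pt_sub mulf_neq0 ?expi_neq0.
have k_n : (k <= n)%N by lia.
have [|Vfree V0] := neutralP nu0 k_n.
  by move=> i ik; rewrite cmod_pt; apply: le_trans xy _; apply: cos_phi_le => //; lia.
rewrite -[k]addn0.
apply: (@numrange_block _ _ _ _ _ _ _ _ (neutral n (pt x y - al) k) 0) => //.
- by move=> i [].
- by move=> [].
- by move=> [].
Qed.

(** [p] counts the indices whose vectors are neutral alone; the other [k - p] need unit vectors of
    [C^m]. If [k > m], the bound by [c_ (k - m)] keeps their number at most [m]. *)
Lemma pt_mem_cone x y : (k.*2 <= n.+1)%N -> (k <= m)%N \/ cmod (Complex x y) <= c_ (k - m) ->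
  cmod (Complex x y) ^+ 2 <= d * x ->
  (d * y) ^+ 2 * (cmod (Complex x y) ^+ 2 - c_ k ^+ 2) <= (d * x - cmod (Complex x y) ^+ 2) ^+
    2 * c_ k ^+ 2 ->
  L (pt x y).
Proof.
move=> kn km rdx cone; have [E|xy0] := eqVneq (Complex x y) 0.
  by case: E => -> ->; apply: pt_mem_origin.
have nu0 : pt x y - al != 0 by rewrite pt_sub mulf_neq0 ?expi_neq0.
have r0 := cmod_gt0 xy0; set r := cmod _ in km rdx cone r0 *.
have r_neq0 : r != 0 by rewrite gt_eqF.
have r2 : r ^+ 2 = x ^+ 2 + y ^+ 2 by exact: sqr_cmodE.
have [|p [pk le_p lt_p]] := @threshold _ (fun i => c_ i.+1) r k.
  by move=> i j ij; apply: cos_phi_le; lia.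
have kpm : (k - p <= m)%N.
  case: km => [|rkm]; first by lia.
  rewrite leqNgt; apply/negP => mkp.
  (* Position [i] of the sequence holds [c_ i.+1], so [c_ (k - m)] sits at [k - m - 1]. *)
  have : c_ (k - m).-1.+1 < r by apply: lt_p; lia.
  by rewrite prednK; [rewrite ltNge rkm|lia].
rewrite -(subnKC pk).
(* The real and imaginary parts of [(be - lam) / (lam - al) = (d - z) / z], where [z = x + i y]. *)
apply: (@numrange_mem _ _ _ _ _ _ _ _ ((d * x - r ^+ 2) / r ^+ 2) (- (d * y) / r ^+ 2)) => //.
- by rewrite subnKC.
- by move=> i ip; rewrite cmod_pt; exact: le_p.
- by rewrite subnKC // => i ip; rewrite cmod_pt; exact: lt_p.
- have -> : be - pt x y = expi ps * (Complex d 0 - Complex x y).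
    by rewrite {1}be_pt /pt; ring.
  rewrite pt_sub -mulrA; congr (_ * _); apply/eqP; rewrite eq_complex /=.
  have xy2 : x ^+ 2 + y ^+ 2 != 0 by rewrite -r2 sqrf_eq0.
  by apply/andP; split; apply/eqP; rewrite r2; field.
- by rewrite divr_ge0 ?sqr_ge0 // subr_ge0.
rewrite subnKC // cmod_pt -/r !expr_div_n sqrrN.
rewrite [X in X <= _]mulrAC [X in _ <= X]mulrAC ler_wpM2r ?invr_ge0 ?exprn_ge0 ?(ltW r0) //.
Qed.

Lemma pt_mem_real x : (k.*2 <= n.+1)%N -> (k <= m)%N \/ x <= c_ (k - m) -> 0 <= x <= d -> L (pt
  x 0).
Proof.
move=> kn km /andP[x0 xd].
have xE : cmod (Complex x 0) = x by rewrite cmod_sqrt expr0n addr0 sqrtr_sqr ger0_norm.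
apply: pt_mem_cone; rewrite ?xE //.
- by rewrite expr2 ler_wpM2r.
- by rewrite mulr0 expr0n mul0r mulr_ge0 ?sqr_ge0.
Qed.

(** Unit vectors of [C^m] come first, then [k - m] neutral vectors if [k > m]. When [be = al], the
    bound reads [c_ (k - m) >= 0], that is [2 (k - m) <= n + 1], as [numrange_mem0] requires. *)
Lemma numrange_be : (k <= m)%N \/ (m < k)%N /\ d <= c_ (k - m) -> L be.
Proof.
move=> km; have [E|be_neq] := eqVneq be al.
  rewrite E; case: km => [km|[mk]].
    by rewrite -[k]add0n; apply: numrange_mem0 => //; right.
  rewrite E subrr cmod_sqrt expr0n addr0 sqrtr0 => /cos_phi_ge0 kmn.
  rewrite -[X in rank_k_numrange X](subnK (ltnW mk)); apply: numrange_mem0 => //; last by right.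
  by apply: kmn; lia.
have nu0 : be - al != 0 by rewrite subr_eq0.
case: km => [km|[mk dkm]].
  by rewrite -[k]add0n; apply: numrange_mem_eigen.
rewrite -[X in rank_k_numrange X](subnK (ltnW mk)); apply: numrange_mem_eigen => //; first by lia.
by move=> i ik; apply: le_trans dkm _; apply: cos_phi_le; lia.
Qed.

(** Since [c_ k < 0], the bound is [d s] in every direction [(s, t)] with [d s >= c_ k], including
    some with [s < 0]; these half-planes meet only in [be]. *)
Lemma numrange_gt_be lam : (n.+1 < k.*2)%N -> L lam -> lam = be.
Proof.
move=> nk Llam; have [kn|] := leqP k n; last by move=> kn; exact: numrange_gtn kn Llam.
have [x [y E]] := ptP lam; rewrite E in Llam *.
have H s t := @pt_halfplane x y s t kn Llam.
have ck : c_ k < 0 by apply: cos_phi_lt0 => //; lia.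
have d0 := d_ge0.
have y0 : y = 0.
  have := H 0 1; have := H 0 (-1); rewrite sqrrN expr1n expr0n add0r mulr0 !add0r !mulr0.
  rewrite mulrN !mulr1 (max_idPr (ltW ck)) => /(_ erefl) ? /(_ erefl) ?.
  by apply/le_anti/andP; split; lra.
have xd : x <= d.
  have := H 1 0; rewrite expr1n expr0n addr0 mulr0 addr0 !mulr1 => /(_ erefl).
  by rewrite (max_idPr (le_trans (ltW ck) d0)).
have dx : d <= x.
  (* Small enough that [- d e >= c_ k]: in a direction with first coordinate [- e] the bound is
     [- d e], which with [y = 0] gives [d <= x]. *)
  pose e := - c_ k / (d + 1).
  have d1 : 0 < d + 1 by lra.
  have e0 : 0 < e by rewrite divr_gt0 // oppr_gt0.
  have e1 : e <= 1.
    by rewrite ler_pdivrMr // mul1r; have := cos_geN1 (phi_ n k : R); lra.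
  have de : d * - e >= c_ k.
    have : e * (d + 1) = - c_ k by rewrite divfK // gt_eqF.
    by nra.
  have e2 : 0 <= 1 - e ^+ 2 by nra.
  have := H (- e) (Num.sqrt (1 - e ^+ 2)).
  rewrite sqrrN sqr_sqrtr // addrC subrK => /(_ erefl).
  rewrite y0 mul0r addr0 (max_idPr de) !mulrN lerN2.
  by rewrite ler_pM2r.
have -> : x = d by apply/le_anti/andP.
by rewrite y0 -be_pt.
Qed.

Lemma cdisk_pt r x y : cdisk r al (pt x y) <-> cmod (Complex x y) <= r.
Proof. by rewrite /cdisk /= cmod_pt. Qed.

Lemma numrange_disk_case : (k.*2 <= n)%N -> d <= c_ k -> L = cdisk (c_ k) al.
Proof.
move=> kn dk; apply/seteqP; split=> lam; have [x [y ->]] := ptP lam.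
  move=> Lxy; apply/cdisk_pt/cmod_support => s t st.
  apply: le_trans (pt_halfplane _ Lxy st) _; first by lia.
  rewrite ge_max lexx /=; apply: le_trans dk.
  by rewrite ler_piMr ?d_ge0 //; have := sqr_ge0 t; nra.
by move=> /cdisk_pt; exact: pt_mem_disk.
Qed.

(** As [cos delta = c_ k / d], the slanted lines bounding [Rregion] are the tangents from [(d, 0)]
    to the circle of radius [c_ k]; [s] is [sin delta]. *)
Lemma cot_delta : 0 < c_ k < d -> let q := cot (delta_ n k al be) in
  [/\ 0 < q, q ^+ 2 * (d ^+ 2 - c_ k ^+ 2) = c_ k ^+ 2 &
   exists s : R, [/\ 0 < s, (c_ k / d) ^+ 2 + s ^+ 2 = 1 & q * s = c_ k / d]].
Proof.
move=> /andP[c0 cd]; have d0 : 0 < d by exact: lt_trans cd.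
have be_neq : be != al by rewrite -subr_eq0; apply: contraTneq d0 => ->; rewrite cmod_sqrt
  expr0n addr0 sqrtr0 ltxx.
rewrite /= /delta_ be_neq (gtr0_norm c0) (ltW cd) /= /cot.
have cd1 : -1 <= c_ k / d <= 1.
  rewrite ler_pdivrMr // mul1r (ltW cd) andbT.
  by rewrite (@le_trans _ _ 0) ?lerN10 // divr_ge0 ?(ltW c0) ?(ltW d0).
rewrite acosK ?in_itv // sin_acos //.
have s2 : 0 < 1 - (c_ k / d) ^+ 2.
  by rewrite subr_gt0 expr_lt1 ?divr_ge0 ?(ltW c0) ?(ltW d0) // ltr_pdivrMr // mul1r.
set s := Num.sqrt _; have s0 : 0 < s by rewrite sqrtr_gt0.
have sE : s ^+ 2 = 1 - (c_ k / d) ^+ 2 by rewrite sqr_sqrtr // ltW.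
split; first by rewrite !divr_gt0.
  rewrite expr_div_n sE.
  have -> : d ^+ 2 - c_ k ^+ 2 = d ^+ 2 * (1 - (c_ k / d) ^+ 2).
    by field; rewrite gt_eqF.
  by rewrite mulrCA divfK ?(gt_eqF s2) // -exprMn mulrC divfK // gt_eqF.
exists s; split => //; first by rewrite sE addrC subrK.
by rewrite divfK // gt_eqF.
Qed.

(** Outside the disk, the bound in the direction of the point must come from [be], which is
    membership in [Etilde]. In the directions [(cos delta, sin delta)] and
    [(cos delta, - sin delta)] both terms of the maximum equal [c_ k], which yields the tangent
    lines. *)
Lemma numrange_sector x y : (k.*2 <= n)%N -> c_ k < d -> c_ k < cmod (Complex x y) ->
  L (pt x y) -> Etilde n k al be (Complex x y) /\ Rregion n k al be d (Complex x y).
Proof.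
move=> kn cd cr Lxy; have k_n : (k <= n)%N by lia.
have H s t := @pt_halfplane x y s t k_n Lxy.
have c0 : 0 < c_ k by exact: cos_phi_gt0.
have d0 : 0 < d by exact: lt_trans cd.
have [q0 _ [u [u0 cu qu]]] := cot_delta (introT andP (conj c0 cd)).
have max_c : Num.max (c_ k) (d * (c_ k / d)) = c_ k by rewrite mulrC divfK ?gt_eqF // maxxx.
split.
  have [t E] := polar x y; exists t; split => //.
  rewrite /Dset /= => le_c; move: (H (cos t) (sin t) (cos2Dsin2 t)).
  rewrite (max_idPl le_c); move: E cr; set r := cmod _ => -[-> ->].
  rewrite !mul0r subr0 addr0 -!mulrA -mulrDr -!expr2 cos2Dsin2 mulr1.
  by move=> /lt_le_trans lt /lt; rewrite ltxx.
rewrite /Rregion /=; set q := cot _ in q0 qu *.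
have up s : s ^+ 2 = u ^+ 2 -> y * s <= (d - x) * (q * u).
  move=> su; have := H (c_ k / d) s; rewrite su cu max_c => /(_ erefl).
  rewrite qu; have -> : (d - x) * (c_ k / d) = c_ k - x * (c_ k / d) by field; rewrite gt_eqF.
  by lra.
have := up u erefl; have := up (- u) (sqrrN _); rewrite !mulrA mulrN -mulNr !ler_pM2r // => ly yl.
split; last by split => //; lra.
by have := H 1 0; rewrite expr1n expr0n addr0 mulr0 addr0 !mulr1 (max_idPr (ltW cd)) => /(_ erefl).
Qed.

(** [Etilde] gives [c r < d x], and squaring [|y| <= (d - x) cot delta] gives the remaining
    condition of [tangent_cone]. *)
Lemma sector_numrange x y : (k.*2 <= n)%N -> c_ k < d ->
  (k <= m)%N \/ cmod (Complex x y) <= c_ (k - m) ->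
  Etilde n k al be (Complex x y) -> Rregion n k al be d (Complex x y) -> L (pt x y).
Proof.
move=> kn cd km [t [E Dt]] [/= xd [ly yl]].
have [|cr] := lerP (cmod (Complex x y)) (c_ k); first exact: pt_mem_disk.
have c0 : 0 < c_ k by exact: cos_phi_gt0.
have [q0 q2 _] := cot_delta (introT andP (conj c0 cd)).
set q := cot _ in ly yl q0 q2.
have cdt : c_ k < d * cos t by rewrite ltNge; apply/negP.
have r0 : 0 < cmod (Complex x y) by exact: lt_trans cr.
have [rdx cone] : cmod (Complex x y) ^+ 2 <= d * x /\
    (d * y) ^+ 2 * (cmod (Complex x y) ^+ 2 - c_ k ^+ 2) <=
    (d * x - cmod (Complex x y) ^+ 2) ^+ 2 * c_ k ^+ 2.
  apply: tangent_cone => //; first exact: sqr_cmodE.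
    move: E r0; set r := cmod _ => -[-> _] r0.
    by rewrite mul0r subr0 mulrC mulrCA ltr_pM2l.
  rewrite -[X in _ <= _ * X]q2 mulrA -exprMn ler_wpM2r //.
    by rewrite subr_ge0 ler_pXn2r ?nnegrE ?(ltW c0) ?(ltW cd) ?d_ge0.
  by nra.
by apply: (pt_mem_cone _ km rdx cone); lia.
Qed.

Lemma numrange_cone : (k.*2 <= n)%N -> (k <= m)%N -> c_ k < d ->
  L = cdisk (c_ k) al `|` (Etilde_psi n k al be ps `&` Rregion_psi n k al be ps d).
Proof.
move=> kn km cd; apply/seteqP; split=> lam; have [x [y ->]] := ptP lam.
  move=> Lxy; have [le|lt] := lerP (cmod (Complex x y)) (c_ k).
    by left; apply/cdisk_pt.
  by have [Exy Rxy] := numrange_sector kn cd lt Lxy; right; split; apply/rot_shift_pt.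
move=> [/cdisk_pt|[/rot_shift_pt Exy /rot_shift_pt Rxy]]; first exact: pt_mem_disk.
by apply: sector_numrange => //; left.
Qed.

Lemma numrange_cone_disk : (k.*2 <= n)%N -> (m < k)%N -> c_ k < d ->
  L = cdisk (c_ k) al `|` (Etilde_psi n k al be ps `&` Rregion_psi n k al be ps d
        `&` cdisk (c_ (k - m)) al).
Proof.
move=> kn mk cd; apply/seteqP; split=> lam; have [x [y ->]] := ptP lam.
  move=> Lxy; have [le|lt] := lerP (cmod (Complex x y)) (c_ k).
    by left; apply/cdisk_pt.
  have [Exy Rxy] := numrange_sector kn cd lt Lxy; right; split; last first.
    by apply/cdisk_pt; exact: pt_disk.
  by split; apply/rot_shift_pt.
move=> [/cdisk_pt|[[/rot_shift_pt Exy /rot_shift_pt Rxy] /cdisk_pt xy]]; first exact: pt_mem_disk.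
by apply: sector_numrange => //; right.
Qed.

Lemma numrange_real x y : (k.*2 = n.+1)%N -> L (pt x y) -> y = 0 /\ 0 <= x <= d.
Proof.
move=> kn Lxy; have k_n : (k <= n)%N by lia.
have H s t := @pt_halfplane x y s t k_n Lxy.
rewrite (cos_phi_half R kn) in H; have d0 := d_ge0.
have := H 0 1; have := H 0 (-1); have := H 1 0; have := H (-1) 0.
rewrite sqrrN !expr1n !expr0n !addr0 !add0r !mulr0 !addr0 !add0r !mulrN !mulr1 maxxx.
have -> : Num.max 0 (- d) = 0 by apply/max_idPl; rewrite oppr_le0.
rewrite (max_idPr d0) => /(_ erefl) ? /(_ erefl) xd /(_ erefl) ? /(_ erefl) ?.
split; first by apply/le_anti/andP; split; lra.
by rewrite xd andbT; lra.
Qed.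

Lemma pt_real t : pt (t * d) 0 = al + t%:C%C * (be - al).
Proof.
rewrite /pt [X in _ = _ + _ * X]be_polar.
have -> : Complex (t * d) 0 = t%:C%C * d%:C%C by rewrite -rmorphM.
by ring.
Qed.

Lemma numrange_segment : (k.*2 = n.+1)%N -> (k <= m)%N \/ (m < k)%N /\ d <= c_ (k - m) ->
  L = segment al be.
Proof.
move=> kn km; have d0 := d_ge0; apply/seteqP; split=> lam.
  have [x [y ->]] := ptP lam; move=> /(numrange_real kn)[-> /andP[x0 xd]].
  have [dE|d_neq0] := eqVneq d 0.
    exists 0; rewrite ?lexx ?ler01 //.
    have -> : x = 0 * d by apply/le_anti; rewrite mul0r x0 -dE xd.
    by rewrite pt_real rmorphB rmorph0 rmorph1; ring.
  have d_gt0 : 0 < d by rewrite lt_def d_neq0.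
  exists (x / d); first by rewrite divr_ge0 //= ler_pdivrMr // mul1r.
  rewrite -[x in LHS](divfK d_neq0) pt_real rmorphB rmorph1.
  by ring.
move=> [t /andP[t0 t1] ->].
have -> : (1 - t)%:C%C * al + t%:C%C * be = pt (t * d) 0.
  by rewrite pt_real rmorphB rmorph1; ring.
have td : t * d <= d by rewrite ler_piMl.
apply: pt_mem_real; first by rewrite kn.
  by case: km => [km|[_ dkm]]; [left|right; exact: le_trans dkm].
by rewrite mulr_ge0.
Qed.

(** As [cos eta = c_ (k - m) / d], the far end lies at distance [c_ (k - m)] from [al]. From [0 < m]
    follows [2 (k - m) <= n], so this cosine is positive. *)
Lemma numrange_short_segment : (k.*2 = n.+1)%N -> (m < k)%N -> c_ (k - m) < d -> (0 < m)%N ->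
  L = [set z | exists2 t : R, 0 <= t <= 1 &
         z = al + (t * cos (eta_ n k m al be))%:C%C * (be - al)].
Proof.
move=> kn mk cd m0; have c0 : 0 < c_ (k - m) by apply: cos_phi_gt0; lia.
have d_gt0 : 0 < d by exact: lt_trans cd.
have d_neq0 : d != 0 by rewrite gt_eqF.
have be_neq : be != al by rewrite -subr_eq0; apply: contraTneq d_gt0 => ->; rewrite cmod_sqrt
  expr0n addr0 sqrtr0 ltxx.
have etaE : cos (eta_ n k m al be) = c_ (k - m) / d.
  have psiE : psi_ n k m = phi_ n (k - m) :> R by rewrite psi_phi ?(ltnW mk).
  rewrite /eta_ mk be_neq psiE (gtr0_norm c0) (ltW cd) /=.
  rewrite acosK; first by [].
  rewrite in_itv /= ler_pdivrMr // mul1r (ltW cd) andbT.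
  by rewrite (@le_trans _ _ 0) ?lerN10 // divr_ge0 ?(ltW c0) ?(ltW d_gt0).
have ptE t : pt (t * c_ (k - m)) 0 = al + (t * cos (eta_ n k m al be))%:C%C * (be - al).
  by rewrite etaE -pt_real -mulrA divfK.
apply/seteqP; split=> lam.
  have [x [y ->]] := ptP lam; move=> Lxy.
  have [y0 /andP[x0 xd]] := numrange_real kn Lxy.
  have := pt_disk mk Lxy; rewrite y0 cmod_sqrt expr0n addr0 sqrtr_sqr ger0_norm // => xc.
  exists (x / c_ (k - m)); first by rewrite divr_ge0 ?(ltW c0) //= ler_pdivrMr // mul1r.
  by rewrite -ptE divfK // gt_eqF.
move=> [t /andP[t0 t1] ->]; rewrite -ptE.
have tc : t * c_ (k - m) <= c_ (k - m) by rewrite ler_piMl // ltW.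
apply: pt_mem_real; rewrite ?kn //; first by right.
by rewrite mulr_ge0 ?(ltW c0) //= (le_trans tc) // ltW.
Qed.

Lemma numrange_singleton : (n.+1 < k.*2)%N -> (k <= m)%N \/ (m < k)%N /\ d <= c_ (k - m) ->
  L = [set be].
Proof.
move=> nk km; apply/seteqP; split=> lam; first exact: numrange_gt_be.
by move=> ->; exact: numrange_be.
Qed.

(** The only candidate [be] lies at distance [d] from [al], beyond the radius allowed by
    [pt_disk]. *)
Lemma numrange_empty : (n.+1 < k.*2)%N -> (m < k)%N -> c_ (k - m) < d -> L = set0.
Proof.
move=> nk mk cd; apply/seteqP; split=> lam //= Llam.
have E := numrange_gt_be nk Llam; move: Llam; rewrite E => Lbe.
have Ld : L (pt d 0) by rewrite -be_pt.
have := pt_disk mk Ld.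
by rewrite cmod_sqrt expr0n addr0 sqrtr_sqr ger0_norm ?d_ge0 // leNgt cd.
Qed.

End Coordinates.
Theorem theorem3p7 (R : realType) (n m : nat) (alpha beta : complex R)
  (k : nat) (ps : R) :
  (2 <= n)%N -> (1 <= m)%N -> (1 <= k <= n + m)%N ->
  beta - alpha = (cmod (beta - alpha))%:C%C * expi ps ->
  let T := Tmat n m alpha beta in
  let d := cmod (beta - alpha) in
  let L := rank_k_numrange k T in
  ((k.*2 <= n)%N -> d <= cos (phi_ n k) ->
     L = cdisk (cos (phi_ n k)) alpha) /\
  ((k.*2 <= n)%N -> (k <= m)%N -> cos (phi_ n k) < d ->
     L = cdisk (cos (phi_ n k)) alpha
         `|` (Etilde_psi n k alpha beta ps `&` Rregion_psi n k alpha beta ps d)) /\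
  ((k.*2 <= n)%N -> (m < k)%N -> cos (phi_ n k) < d ->
     L = cdisk (cos (phi_ n k)) alpha
         `|` (Etilde_psi n k alpha beta ps `&` Rregion_psi n k alpha beta ps d
              `&` cdisk (cos (psi_ n k m)) alpha)) /\
  ((k.*2 = n.+1)%N -> ((k <= m)%N \/ ((m < k)%N /\ d <= cos (psi_ n k m))) ->
     L = segment alpha beta) /\
  ((k.*2 = n.+1)%N -> (m < k)%N -> cos (psi_ n k m) < d ->
     L = [set z | exists2 t : R, 0 <= t <= 1 &
                  z = alpha + (t * cos (eta_ n k m alpha beta))%:C%C * (beta - alpha)]) /\
  ((n.+1 < k.*2)%N -> ((k <= m)%N \/ ((m < k)%N /\ d <= cos (psi_ n k m))) ->
     L = [set beta]) /\
  ((n.+1 < k.*2)%N -> (m < k)%N -> cos (psi_ n k m) < d ->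
     L = set0).
Proof.
move=> n2 m1 k_itv be_polar T d L.
have n0 : (0 < n)%N by lia.
have psiE : (m < k)%N -> psi_ n k m = phi_ n (k - m) :> R by move=> mk; rewrite psi_phi // ltnW.
have km_psi : (k <= m)%N \/ (m < k)%N /\ d <= cos (psi_ n k m) ->
    (k <= m)%N \/ (m < k)%N /\ d <= cos (phi_ n (k - m)).
  by case=> [|[mk]]; [left|rewrite psiE //; right].
split; first exact: (numrange_disk_case n0 k_itv be_polar).
split; first exact: (numrange_cone n0 k_itv be_polar).
split.
  move=> kn mk; rewrite psiE // => cd.
  exact: (numrange_cone_disk n0 k_itv be_polar kn mk cd).
split; first by move=> kn /km_psi; exact: (numrange_segment n0 k_itv be_polar kn).
split.
  move=> kn mk; rewrite psiE // => cd.
  exact: (numrange_short_segment n0 k_itv be_polar kn mk cd m1).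
split; first by move=> nk /km_psi; exact: (numrange_singleton n0 k_itv be_polar nk).
move=> nk mk; rewrite psiE //; exact: (numrange_empty n0 k_itv be_polar nk mk).
Qed.
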